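(* Let $\Omega\subset\mathbb{R}^d$ be a bounded domain with compact Lipschitz boundary, let $\mu$ be a finite positive Radon measure on $\Omega$, let $u\colon\Omega\to\mathbb{R}^m$ be $\mu$-measurable, and let $\eta=\mathrm{gr}^u_\#\mu$ be the associated $u$-graphical measure on $\Omega\times\mathbb{R}^m$, where $\mathrm{gr}^u(x)=(x,u(x))$. For each $x\in\Omega$ let $(c_r^x)_{r>0}\subset(0,\infty)$ satisfy $\lim_{r\downarrow0}c_r^x=0$ and let $(y_r^x)_{r>0}\subset\mathbb{R}^m$ satisfy $\lim_{r\downarrow0}y_r^x=u(x)$. Then: (i) If $\lambda$ is a (possibly vector-valued) finite Radon measure on $\Omega\times\mathbb{R}^m$ with $\lambda\perp\eta$, then $$0=\frac{d\lambda}{d\eta}(x,u(x))=\lim_{r\to0}\frac{\lambda\big(\overline{B(x,r)\times B(y_r^x,c_r^x)}\big)}{\pi_\#\eta(\overline{B(x,r)})}=\lim_{r\to0}\frac{\lambda\big(\overline{B(x,r)\times B(y_r^x,c_r^x)}\big)}{\mu(\overline{B(x,r)})}$$ for $\eta$-almost every $(x,u(x))\in\Omega\times\mathbb{R}^m$. (ii) For any $g\in L^1(\Omega\times\mathbb{R}^m,\eta)$, $$\lim_{r\to0}\frac1{\mu(\overline{B(x,r)})}\int_{\overline{B(x,r)}\times\mathbb{R}^m}|g(\overline x,y)-g(x,u(x))|\,d\eta(\overline x,y)=0$$ for $\mu$-almost every $x\in\Omega$. (iii) If $\lambda$ is a finite Radon measure on $\Omega\times\mathbb{R}^m$, then $$\frac{d\lambda}{d\eta}(x,u(x))=\lim_{r\to0}\frac{\lambda\big(\overline{B(x,r)\times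 B(y_r^x,c_r^x)}\big)}{\pi_\#\eta(\overline{B(x,r)})}=\lim_{r\to0}\frac{\lambda\big(\overline{B(x,r)\times B(y_r^x,c_r^x)}\big)}{\mu(\overline{B(x,r)})}$$ for $\eta$-almost every $(x,u(x))\in\Omega\times\mathbb{R}^m$ for which $(c_r^x)_r$ and $(y_r^x)_r$ are such that $$\lim_{r\to0}\frac{\eta\big(\overline{B(x,r)\times B(y_r^x,c_r^x)}\big)}{\mu(\overline{B(x,r)})}=1.$$
   Context: $B(x,r)$ denotes the open ball of centre $x$ and radius $r$; $\pi\colon\Omega\times\mathbb{R}^m\to\Omega$ is $\pi(x,y)=x$; $T_\#$ denotes pushforward of measures. $\frac{d\lambda}{d\eta}$ denotes the Radon--Nikodym density of the $\eta$-absolutely continuous part of $\lambda$ with respect to $\eta$. *)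

(* Defs.v *)
From HB Require Import structures.
From mathcomp Require Import all_boot all_order all_algebra.
From mathcomp Require Import all_classical all_reals all_analysis.
From mathcomp Require Import measurable_realfun.

Set Implicit Arguments.
Unset Strict Implicit.
Unset Printing Implicit Defensive.

Import Order.TTheory GRing.Theory Num.Theory.
Import numFieldNormedType.Exports.

Local Open Scope classical_set_scope.
Local Open Scope ring_scope.

(* Matrices (hence vectors of R^n) carry their Borel sigma-algebra. The library
   topology on 'rV[R]_n comes from the sup norm; it is the Euclidean one. *)
Section borel_matrix.
Variables (R : realType) (m n : nat).
Let G : set (set 'M[R]_(m, n)) := open.

HB.instance Definition _ := @isMeasurable.Build (sigma_display G) 'M[R]_(m, n)
  <<s G >> (@sigma_algebra0 _ setT G) (@sigma_algebraC _ G)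
  (@sigma_algebra_bigcup _ setT G).
End borel_matrix.

Section euclidean_space.
Context {R : realType}.

Definition enorm {n : nat} (x : 'rV[R]_n) : R :=
  Num.sqrt (\sum_(i < n) x 0 i ^+ 2).

(* The library's [ball] is a cube for the sup norm, hence a separate notion. *)
Definition eball {n : nat} (x : 'rV[R]_n) (r : R) : set 'rV[R]_n :=
  [set z | enorm (z - x) < r].

Definition closed_cylinder {n m : nat} (x : 'rV[R]_n) (r : R) (y : 'rV[R]_m)
    (c : R) : set ('rV[R]_n * 'rV[R]_m) :=
  closure (eball x r `*` eball y c).

Definition boundary {T : topologicalType} (A : set T) : set T :=
  closure A `\` interior A.

(* Near each boundary point, in suitable orthonormal coordinates and with one
   coordinate i singled out, Omega is the strict epigraph of a Lipschitz
   function of the remaining coordinates. *)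
Definition lipschitz_boundary {n : nat} (Omega : set 'rV[R]_n) : Prop :=
  forall p, boundary Omega p ->
  exists (Q : 'M[R]_n) (i : 'I_n) (gamma : 'rV[R]_n.-1 -> R) (r : R),
    [/\ Q *m Q^T = 1%:M, lipschitz gamma, 0 < r &
        forall z, eball p r z ->
          (Omega z <-> gamma (col' i (z *m Q)) < (z *m Q) 0 i)].

Definition bounded_lipschitz_domain {n : nat} (Omega : set 'rV[R]_n) : Prop :=
  [/\ Omega !=set0, open Omega, connected Omega, bounded_set Omega &
      compact (boundary Omega) /\ lipschitz_boundary Omega].

End euclidean_space.

Section graphical_measure.
Context {d} {T : measurableType d} {R : realType} {m : nat}.
Implicit Types (mu : {finite_measure set T -> \bar R}) (u : T -> 'rV[R]_m).

(* The Caratheodory sigma-algebra of mu^* is the mu-completion of the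
   sigma-algebra of T, as mu is finite. *)
Definition mu_measurable mu (D : set T) u : Prop :=
  measurable_fun (D : set (caratheodory_type (mu^*)%mu)) u.

Definition graph_map u (x : T) : T * 'rV[R]_m := (x, u x).

(* The completion of mu is needed here: the preimage of a measurable set by a
   mu-measurable map is only mu-measurable. *)
Definition is_graphical_measure mu u
    (eta : {finite_measure set (T * 'rV[R]_m)%type -> \bar R}) : Prop :=
  forall A, measurable A ->
    eta A =
    pushforward (@completed_measure_extension _ _ _ mu) (graph_map u) A.

Lemma graphical_measure_exists mu (D : set T) u :
  measurable D -> mu (~` D) = 0%E -> mu_measurable mu D u ->
  exists eta, is_graphical_measure mu u eta.
Proof.
move=> mD muD mu_u.
pose C : measurableType _ := caratheodory_type (mu^*)%mu.
have mug : measurable_fun (setT : set C) (graph_map u : C -> _).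
  apply: measurable_fun_pair.
    by move=> _ A mA; rewrite setTI; exact: caratheodory_measurable_mu_ext.
  move=> _ B mB; rewrite setTI -(setIT (u @^-1` B)) -(setUv D) setIUr.
  apply: measurableU.
    by rewrite setIC; apply: mu_u => //; exact: caratheodory_measurable_mu_ext.
  apply: measure_is_complete_caratheodory; exists (~` D); split => //.
  - by apply: caratheodory_measurable_mu_ext; exact: measurableC.
  - by rewrite -muD; apply: measurable_mu_extE; exact: measurableC.
pose P := @measure_function_pushforward__canonical__measure_function_Measure
  _ _ _ _ _ (@completed_measure_extension _ _ _ mu) _ mug.
have Pfin : fin_num_fun P.
  move=> A mA; rewrite ge0_fin_numE//.
  apply: (@le_lt_trans _ _ ((mu^*)%mu setT)); first exact: le_mu_ext.
  by rewrite measurable_mu_extE// ltey_eq fin_num_measure.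
pose eta : {finite_measure set (T * 'rV[R]_m)%type -> \bar R} :=
  HB.pack_for {finite_measure set (T * 'rV[R]_m)%type -> \bar R}
    (Measure.sort P) (Measure_isFinite.Build _ _ _ (Measure.sort P) Pfin).
by exists eta => A mA.
Qed.

End graphical_measure.

Section lebesgue_decomposition.
Context {d} {T : measurableType d} {R : realType}.
Implicit Types (lambda : {charge set T -> \bar R})
               (eta : {finite_measure set T -> \bar R}).
Local Open Scope ereal_scope.
Local Open Scope charge_scope.

Definition mutually_singular (m1 m2 : set T -> \bar R) : Prop :=
  exists A, [/\ measurable A, m1.-null_set (~` A) & m2.-null_set A].

Lemma lebesgue_decomposition lambda eta :
  exists lambda_a : {charge set T -> \bar R},
  exists lambda_s : {charge set T -> \bar R},
    [/\ lambda_a `<< eta, mutually_singular lambda_s eta &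
        forall A, measurable A -> lambda A = lambda_a A + lambda_s A].
Proof.
have [P [N PN]] := Hahn_decomposition lambda.
pose m1 : {measure set T -> \bar R} := measure_add eta (jordan_pos PN).
pose m2 : {measure set T -> \bar R} := measure_add m1 (jordan_neg PN).
have m2E A : m2 A = eta A + jordan_pos PN A + jordan_neg PN A.
  have -> : eta A + jordan_pos PN A = m1 A by exact/esym/measure_addE.
  exact: measure_addE.
have m2fin : fin_num_fun m2.
  by move=> A mA; rewrite m2E !fin_numD !fin_num_measure.
pose m : {finite_measure set T -> \bar R} :=
  HB.pack_for {finite_measure set T -> \bar R} (Measure.sort m2)
    (Measure_isFinite.Build _ _ _ (Measure.sort m2) m2fin).
have m0 A : m A = 0 ->
    [/\ eta A = 0, jordan_pos PN A = 0 & jordan_neg PN A = 0].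
  rewrite [m A]m2E => /eqP; rewrite !padde_eq0 ?adde_ge0//.
  by move=> /andP[/andP[/eqP-> /eqP->] /eqP->].
have etam : charge_of_finite_measure eta `<< m.
  by apply/null_content_dominatesP => A mA /m0[].
pose h := 'd (charge_of_finite_measure eta) '/d m.
have mh : measurable_fun setT h.
  by apply: measurable_int; exact: Radon_Nikodym_integrable.
have hE A : measurable A -> eta A = \int[m]_(x in A) h x.
  by move=> mA; rewrite -(Radon_Nikodym_integral etam mA).
pose Z := [set x | h x <= 0].
have mZ : measurable Z.
  by rewrite -[Z]setTI; exact: emeasurable_fun_infty_c.
have mZC : measurable (~` Z) by exact: measurableC.
have etaZ : eta Z = 0.
  apply/eqP; rewrite eq_le measure_ge0 andbT (hE _ mZ).
  rewrite -[leRHS](integral0 m Z); apply: le_integral => //.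
  - by apply: integrableS (Radon_Nikodym_integrable etam).
  - exact: integrable0.
  - by move=> x; rewrite inE.
exists (crestr0 lambda mZC), (crestr0 lambda mZ); split.
- apply/null_content_dominatesP => A mA etaA.
  rewrite /= /crestr0 mem_set// /crestr; set B := A `&` ~` Z.
  have mB : measurable B by exact: measurableI.
  have etaB : eta B = 0.
    by apply/eqP; rewrite -measure_le0 -etaA le_measure ?inE//; exact: subIsetl.
  have hB0 : \int[m]_(x in B) `|h x| = 0.
    rewrite -etaB (hE _ mB); apply: eq_integral => x; rewrite inE => -[_ /negP].
    by rewrite -ltNge => /ltW h0; rewrite gee0_abs.
  have /(ae_eq_integral_abs m mB (measurable_funS measurableT _ mh)) := hB0.
  move=> /(_ (@subsetT _ _)) [C [mC mC0 BC]].
  have mB0 : m B = 0.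
    apply/eqP; rewrite -measure_le0 -mC0 le_measure ?inE//.
    move=> x Bx; apply: BC => /= /(_ Bx) hx0.
    by case: Bx => _; apply; rewrite /Z /= hx0.
  have [_ p0 n0] := m0 _ mB0.
  rewrite (jordan_decomp PN mB).
  transitivity (jordan_pos PN B + (-1)%:E * jordan_neg PN B); first by [].
  by rewrite p0 n0 mule0 adde0.
- exists Z; split => //.
    move=> A mA AZ; rewrite /= /crestr0 mem_set// /crestr.
    by move/disjoints_subset : AZ => ->; exact: charge0.
  by apply/measure0_null_setP.
- move=> A mA; rewrite /= /crestr0 !mem_set// /crestr addeC -chargeU//.
  + by rewrite -setIUr setUv setIT.
  + exact: measurableI.
  + exact: measurableI.
  + by rewrite setIACA setICr setI0.
Qed.

(* The part is unique, so the choice made here is immaterial. *)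
Definition ac_part lambda eta : {charge set T -> \bar R} :=
  sval (cid (lebesgue_decomposition lambda eta)).

Definition ac_density lambda eta : T -> \bar R := 'd (ac_part lambda eta) '/d eta.

End lebesgue_decomposition.

(* A finite R^k-valued measure is given by its k components, which are finite
   signed measures. Null sets of the vector measure, i.e. of its total
   variation, are the common null sets of the components. *)
Section vector_measure.
Context {d} {T : measurableType d} {R : realType} {k : nat}.
Implicit Types (lambda : 'I_k -> {charge set T -> \bar R})
               (eta : {finite_measure set T -> \bar R}).

Definition vval lambda (A : set T) : 'rV[R]_k := \row_i fine (lambda i A).

Definition vnull lambda (N : set T) : Prop := forall i, (lambda i).-null_set N.

Definition vsingular lambda eta : Prop :=
  exists A, [/\ measurable A, vnull lambda (~` A) & eta.-null_set A].

Definition vdensity lambda eta (z : T) : 'rV[R]_k :=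
  \row_i fine (ac_density (lambda i) eta z).

End vector_measure.

(* Main.v *)
Require Import Defs.
From HB Require Import structures.
From mathcomp Require Import all_boot all_order all_algebra.
From mathcomp Require Import all_classical all_reals all_analysis.
From mathcomp Require Import measurable_realfun.
From mathcomp Require Import ring lra.

Import Order.TTheory GRing.Theory Num.Theory.
Import numFieldNormedType.Exports.

Local Open Scope classical_set_scope.
Local Open Scope ring_scope.

(** The ratios are controlled by a maximal inequality for an arbitrary finite
    measure [mu] on R^d, whose only geometric input is Besicovitch's covering
    argument.  When the candidate balls have finitely many radii and bounded
    centres, choosing the larger radii first yields finitely many balls that
    cover the centres and none of which contains the centre of another
    ([besicovitch_cover]).  The directions from a point common to several such
    balls towards their centres form angles larger than 60 degrees, so that
    their number is bounded by a dimensional constant [N]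
    ([sepballs_overlap]).  It follows that the set where [nu] exceeds [t * mu]
    on some ball has [mu]-measure at most [N / t] times the mass of [nu]
    ([maximal_inequality]).  Consequently a quantity which, near each point of
    a set, is dominated by [nu (B (x, r))] with [nu] of arbitrarily small mass
    is [o (mu (B (x, r)))] at [mu]-almost every point of that set
    ([small_domination_ae]).

    If [lambda] is singular to [eta], it vanishes on a set carrying [eta], and
    outer regularity gives an open neighbourhood [U] of that set of small
    [lambda]-variation.  Over a point [x] with [(x, u x)] in [U], the small
    cylinders lie in [U], hence their [lambda]-measure is at most the mass that
    the projection of [lambda] restricted to [U] gives to the ball around [x].
    This is (i); it is here that the cylinders have to shrink to the point
    [(x, u x)] ([cylinder_null_ae]).

    For (ii), [g] is cut into level cells of height [e].  At a point of the
    graph in a given cell, [|g - g (x, u x)|] is at most [e] on the cell, and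
    is bounded outside the cell by an integrable function [phi] which vanishes
    on the cell.  As [eta] lives on the graph, the measure [phi * eta] gives no
    mass to the fibres over the points whose graph point is in the cell, so
    that its projection is negligible on small balls around almost every such
    point ([fiber_null_ae], [graph_lebesgue_point_ae]).

    Finally (iii) follows by splitting [lambda]: the singular part is treated
    by (i), and for the part of density [g] the difference between its value
    on a cylinder and [g (x, u x)] times the [eta]-measure of the cylinder is
    bounded by the integral in (ii), since the cylinder lies in the full
    cylinder over the ball. *)

(** * Euclidean geometry and Besicovitch's covering argument *)

Section euclidean_norm.
Context {R : realType} {n : nat}.
Implicit Types x y a b : 'rV[R]_n.

Lemma enorm_ge0 x : 0 <= enorm x.
Proof. exact: sqrtr_ge0. Qed.

Lemma sqr_enorm x : enorm x ^+ 2 = \sum_(i < n) x 0 i ^+ 2.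
Proof. by rewrite sqr_sqrtr// sumr_ge0// => i _; exact: sqr_ge0. Qed.

Lemma enormZ (k : R) x : enorm (k *: x) = `|k| * enorm x.
Proof.
rewrite /enorm; under eq_bigr do rewrite mxE exprMn.
by rewrite -mulr_sumr sqrtrM ?sqr_ge0// sqrtr_sqr.
Qed.

Lemma enormBC x y : enorm (x - y) = enorm (y - x).
Proof. by rewrite -opprB -scaleN1r enormZ normrN1 mul1r. Qed.

Lemma normr_coord_le_enorm x i : `|x 0 i| <= enorm x.
Proof.
rewrite -(@ler_pXn2r _ 2)// ?nnegrE ?enorm_ge0//.
rewrite sqr_enorm real_normK ?num_real// (bigD1 i)//= lerDl sumr_ge0// => j _.
exact: sqr_ge0.
Qed.

Lemma sqr_enorm_le_coord x (e : R) :
  (forall i, `|x 0 i| <= e) -> enorm x ^+ 2 <= n%:R * e ^+ 2.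
Proof.
move=> xe; rewrite sqr_enorm.
apply: (@le_trans _ _ (\sum_(i < n) e ^+ 2)).
  apply: ler_sum => i _; rewrite -real_normK ?num_real//.
  by rewrite ler_pXn2r// nnegrE// (le_trans _ (xe i)).
by rewrite sumr_const card_ord mulr_natl.
Qed.

Lemma sqr_enormB a b :
  enorm (a - b) ^+ 2 = enorm a ^+ 2 + enorm b ^+ 2 - 2 * \sum_(i < n) a 0 i * b 0 i.
Proof.
rewrite !sqr_enorm mulr_sumr -big_split -sumrB/=; apply: eq_bigr => i _.
rewrite !mxE; ring.
Qed.

(** If two vectors are at distance larger than both their norms, the angle
    between them exceeds 60 degrees, so their directions are at distance at
    least 1. *)
Lemma enorm_direction_sep a b :
  enorm a < enorm (a - b) -> enorm b < enorm (a - b) ->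
  1 <= enorm ((enorm a)^-1 *: a - (enorm b)^-1 *: b).
Proof.
move=> hA hB.
have A0 : 0 < enorm a.
  rewrite lt_neqAle enorm_ge0 andbT; apply/eqP => A0; move: hB.
  have /(_ _) a0 i : a 0 i = 0.
    by apply/eqP; rewrite -normr_le0 A0 normr_coord_le_enorm.
  by have -> : a = 0; [apply/rowP => i; rewrite a0 mxE|rewrite enormBC subr0 ltxx].
have B0 : 0 < enorm b.
  rewrite lt_neqAle enorm_ge0 andbT; apply/eqP => B0; move: hA.
  have /(_ _) b0 i : b 0 i = 0.
    by apply/eqP; rewrite -normr_le0 B0 normr_coord_le_enorm.
  by have -> : b = 0; [apply/rowP => i; rewrite b0 mxE|rewrite subr0 ltxx].
have hA2 : enorm a ^+ 2 < enorm (a - b) ^+ 2.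
  by rewrite ltr_pXn2r ?nnegrE ?enorm_ge0.
have hB2 : enorm b ^+ 2 < enorm (a - b) ^+ 2.
  by rewrite ltr_pXn2r ?nnegrE ?enorm_ge0.
rewrite -(@ler_pXn2r _ 2)// ?nnegrE ?enorm_ge0//.
rewrite sqr_enormB !enormZ !normfV !ger0_norm ?enorm_ge0//.
rewrite !mulVf ?gt_eqF// expr1n.
under eq_bigr do rewrite !mxE mulrACA.
rewrite -mulr_sumr.
rewrite !sqr_enormB in hA2 hB2.
set P := \sum_(i < n) _ in hA2 hB2 *.
move: (enorm a) (enorm b) A0 B0 hA2 hB2 => A B A0 B0 hA2 hB2.
suff : 2 * (A^-1 / B * P) <= 1 by lra.
have -> : 2 * (A^-1 / B * P) = (2 * P) / (A * B) by field; rewrite !gt_eqF.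
rewrite ler_pdivrMr ?mulr_gt0// mul1r.
have [AB|/ltW BA] := leP A B.
  apply: (@le_trans _ _ (A ^+ 2)); first lra.
  by rewrite expr2 ler_pM2l.
apply: (@le_trans _ _ (B ^+ 2)); first lra.
by rewrite expr2 ler_pM2r.
Qed.

End euclidean_norm.

Section besicovitch.
Context {R : realType}.

(** A bounded set contains only boundedly many points at mutual distance at
    least [delta]: a grid of small mesh separates them. *)
Lemma separated_size_bound n (b delta : R) : 0 < delta ->
  exists M : nat, forall s : seq 'rV[R]_n,
    all (fun x => enorm x <= b) s ->
    pairwise (fun x y => delta <= enorm (x - y)) s -> (size s <= M)%N.
Proof.
move=> delta0; pose e := delta / n.+1%:R.
have e0 : 0 < e by rewrite divr_gt0.
pose K := Num.truncn (2 * b / e).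
exists #|{ffun 'I_n -> 'I_K.+1}| => s sb ssep.
pose f (x : 'rV[R]_n) : {ffun 'I_n -> 'I_K.+1} :=
  [ffun i => inord (Num.truncn ((x 0 i + b) / e))].
rewrite -(size_map f); apply: (@leq_trans #|map f s|); last exact: max_card.
suff /card_uniqP -> : uniq (map f s) by [].
rewrite uniq_pairwise pairwise_map.
apply: (sub_in_pairwise _ sb ssep) => x y; rewrite !unfold_in => xb yb.
apply: contraTneq => fxy; rewrite -ltNge.
rewrite -(@ltr_pXn2r _ 2)// ?nnegrE ?enorm_ge0 ?(ltW delta0)//.
have xye i : `|(x - y) 0 i| <= e.
  have /ffunP/(_ i) := fxy; rewrite !ffunE => /(congr1 val)/=.
  have co (z : 'rV[R]_n) : enorm z <= b ->
      0 <= (z 0 i + b) / e /\ (Num.truncn ((z 0 i + b) / e)%R < K.+1)%N.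
    move=> zb; have := le_trans (normr_coord_le_enorm z i) zb.
    rewrite ler_norml => /andP[zb1 zb2]; split.
      by apply: divr_ge0; [lra|exact: ltW].
    rewrite ltnS; apply: le_truncn; rewrite ler_pM2r ?invr_gt0//; lra.
  have [x0 xK] := co _ xb; have [y0 yK] := co _ yb.
  rewrite !inordK// => txy.
  have /andP[x1 x2] := truncn_itv x0; have /andP[y1 y2] := truncn_itv y0.
  rewrite txy in x1 x2.
  have : `|(x 0 i + b) / e - (y 0 i + b) / e| <= 1.
    by rewrite ler_norml; rewrite -natr1 in x2 y2; lra.
  rewrite -mulrBl normrM (gtr0_norm (x := e^-1)) ?invr_gt0// ler_pdivrMr// mul1r.
  by rewrite !mxE; congr (`|_| <= _); ring.
apply: (le_lt_trans (sqr_enorm_le_coord _ _ xye)).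
rewrite /e expr_div_n mulrA ltr_pdivrMr ?exprn_gt0// mulrC ltr_pM2l ?exprn_gt0//.
by rewrite -natrX ltr_nat expnS expn1 mulSn ltn_addr.
Qed.

(** Two balls, given as pairs of a centre and a radius, neither of which
    contains the centre of the other. *)
Definition sepballs {n} (p q : 'rV[R]_n * R) : bool :=
  (p.2 < enorm (p.1 - q.1)) && (q.2 < enorm (p.1 - q.1)).

(** A point lies in boundedly many pairwise separated balls: the directions
    from it to their centres are separated by [enorm_direction_sep]. *)
Lemma sepballs_overlap n : exists N : nat,
  forall (s : seq ('rV[R]_n * R)) (z : 'rV[R]_n), pairwise sepballs s ->
    (count (fun p : 'rV[R]_n * R => (enorm (z - p.1) <= p.2)%R) s <= N)%N.
Proof.
have [N HN] := @separated_size_bound n 1 1 ltr01.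
exists N => s z ssep; rewrite -size_filter.
pose dir (p : 'rV[R]_n * R) := (enorm (z - p.1))^-1 *: (z - p.1).
rewrite -(size_map dir); apply: HN.
  rewrite all_map; apply/allP => p _ /=; rewrite enormZ normfV ger0_norm ?enorm_ge0//.
  have [->|p0] := eqVneq (enorm (z - p.1)) 0; first by rewrite mulr0.
  by rewrite mulVf.
rewrite pairwise_map.
apply: (@sub_in_pairwise _ (fun p => enorm (z - p.1) <= p.2) sepballs) => /=.
- move=> p q; rewrite !unfold_in => zp zq /andP[pq qp].
  have E : enorm (p.1 - q.1) = enorm ((z - p.1) - (z - q.1)).
    rewrite enormBC; congr enorm; apply/rowP => i; rewrite !mxE; ring.
  by apply: enorm_direction_sep; rewrite -E; [apply: le_lt_trans zp pq|
    apply: le_lt_trans zq qp].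
- exact: filter_all.
- by apply: subseq_pairwise ssep; exact: filter_subseq.
Qed.

Lemma maximal_separated n (b rho : R) (V : set 'rV[R]_n) : 0 < rho ->
  (forall x, V x -> enorm x <= b) ->
  exists s : seq 'rV[R]_n, [/\ forall x, x \in s -> V x,
    pairwise (fun x y => rho < enorm (x - y)) s &
    forall x, V x -> exists2 y, y \in s & enorm (x - y) <= rho].
Proof.
move=> rho0 Vb; have [M HM] := @separated_size_bound n b rho rho0.
pose P (k : nat) := `[< exists s : seq 'rV[R]_n, [/\ size s = k,
  forall x, x \in s -> V x & pairwise (fun x y => rho < enorm (x - y)) s] >].
have P0 : exists k, P k by exists 0%N; apply/asboolP; exists [::].
have PM k : P k -> (k <= M)%N.
  move=> /asboolP[s [<- sV ssep]]; apply: HM.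
    by apply/allP => x /sV/Vb.
  by apply: sub_pairwise ssep => x y /ltW.
have := ex_maxnP P0 PM => -[k /asboolP[s [sk sV ssep]] kmax].
exists s; split => // x Vx; apply: contrapT => nx.
have /kmax : P k.+1; last by rewrite ltnn.
apply/asboolP; exists (x :: s); split => /=; first by rewrite sk.
  by move=> z; rewrite inE => /predU1P[->//|/sV].
rewrite ssep andbT; apply/allP => z zs; rewrite ltNge; apply/negP => xz.
by apply: nx; exists z.
Qed.

(** Besicovitch covering for finitely many radii: [V r] is the set of centres
    of the candidate balls of radius [r]. *)
Lemma besicovitch_cover n (b : R) (l : seq R) (V : R -> set 'rV[R]_n) :
  all (fun r => 0 < r) l -> (forall r x, V r x -> enorm x <= b) ->
  exists s : seq ('rV[R]_n * R), [/\ pairwise sepballs s,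
    forall p, p \in s -> p.2 \in l /\ V p.2 p.1 &
    forall r x, r \in l -> V r x -> exists2 p, p \in s & enorm (x - p.1) <= p.2].
Proof.
(* larger radii first: each new centre avoids the larger balls already chosen *)
move=> l0 Vb.
wlog lsort : l l0 / pairwise (fun x y : R => y <= x) l.
  move=> H; have [||s [s1 s2 s3]] := H (sort (fun x y : R => y <= x) l).
  - by rewrite all_sort.
  - rewrite -sorted_pairwise; last by move=> ? ? ? h1 h2; exact: le_trans h2 h1.
    by apply: sort_sorted => ? ?; exact: ge_total.
  exists s; split => // [p /s2|r x]; first by rewrite mem_sort.
  by move=> rl; apply: s3; rewrite mem_sort.
elim: l V Vb l0 lsort => [|rho l ih] V Vb /=; first by exists [::].
move=> /andP[rho0 l0] /andP[rhol lsort].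
have [s1 [s1V s1sep s1cov]] := @maximal_separated n b rho (V rho) rho0 (Vb rho).
pose V' r := V r `&` [set x | forall y, y \in s1 -> rho < enorm (y - x)].
have [||//|s2 [s2sep s2V s2cov]] := ih V'; first by move=> r x [/Vb].
  by [].
exists (map (fun x => (x, rho)) s1 ++ s2); split.
- rewrite pairwise_cat s2sep pairwise_map andbT; apply/andP; split.
    apply/allrelP => p q /mapP[x xs1 ->] /s2V[ql [_ /(_ _ xs1) qx]].
    rewrite /sepballs/= qx (le_lt_trans _ qx)//.
    exact: (allP rhol).
  by apply: sub_pairwise s1sep => x y h; rewrite /sepballs/= h.
- move=> p; rewrite mem_cat => /orP[/mapP[x xs1 ->]/=|/s2V[pl [Vp _]]].
    by rewrite inE eqxx; split => //; exact: s1V.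
  by rewrite inE pl orbT.
- move=> r x; rewrite inE => /predU1P[->|rl] Vx.
    have [y ys1 xy] := s1cov _ Vx; exists (y, rho) => //.
    by rewrite mem_cat map_f.
  have [[y ys1 xy]|nx] := pselect (exists2 y, y \in s1 & enorm (x - y) <= rho).
    by exists (y, rho) => //; rewrite mem_cat map_f.
  have [|p ps2 xp] := s2cov r x rl.
    split=> // y ys1; rewrite ltNge; apply/negP => yx; apply: nx; exists y => //.
    by rewrite enormBC.
  by exists p => //; rewrite mem_cat ps2 orbT.
Qed.

End besicovitch.

(** * Closed balls: topology and measurability *)

Section closed_balls.
Context {R : realType}.

(** Closed Euclidean ball. *)
Definition cball {n} (x : 'rV[R]_n) (r : R) : set 'rV[R]_n :=
  [set z | enorm (z - x) <= r].

Lemma cball_le n (x : 'rV[R]_n) (r s : R) : r <= s -> cball x r `<=` cball x s.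
Proof. by move=> rs z /le_trans; exact. Qed.

Lemma open_measurable_rV n (A : set 'rV[R]_n) : open A -> measurable A.
Proof. by move=> oA; exact: sub_sigma_algebra. Qed.

Lemma closed_measurable_rV n (A : set 'rV[R]_n) : closed A -> measurable A.
Proof.
move=> cA; rewrite -(setCK A); apply: measurableC.
by apply: open_measurable_rV; rewrite openC.
Qed.

Lemma measurable_coord n (i : 'I_n) :
  measurable_fun setT (fun x : 'rV[R]_n => x 0 i).
Proof.
apply: (measurability _ (RGenOpens.measurableE R)).
move=> _ [_ [a [b ->] <-]]; rewrite setTI; apply: open_measurable_rV.
have /continuousP := @coord_continuous R 1 n 0 i; apply; exact: interval_open.
Qed.

Lemma measurable_enormB n :
  measurable_fun setT (fun p : 'rV[R]_n * 'rV[R]_n => enorm (p.2 - p.1)).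
Proof.
apply: (measurableT_comp (continuous_measurable_fun (@sqrt_continuous R))).
apply: measurable_sum => i; apply: measurable_funX.
have -> : (fun p : 'rV[R]_n * 'rV[R]_n => (p.2 - p.1) 0 i) =
    (fun p : 'rV[R]_n * 'rV[R]_n => p.2 0 i) \-
    (fun p : 'rV[R]_n * 'rV[R]_n => p.1 0 i).
  by apply/funext => p; rewrite /= !mxE.
by apply: measurable_funB; apply: (measurableT_comp (measurable_coord n i)).
Qed.

Lemma measurable_cball_measure n (nu : {finite_measure set 'rV[R]_n -> \bar R})
  (r : R) : measurable_fun setT (fun x => nu (cball x r)).
Proof.
pose A := [set p : 'rV[R]_n * 'rV[R]_n | enorm (p.2 - p.1) <= r].
have mA : measurable A.
  rewrite -[A]setTI; apply: measurable_fun_le => //; exact: measurable_enormB.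
have := measurable_fun_xsection nu mA.
by congr measurable_fun; apply/funext => x /=; congr (nu _); apply/seteqP;
  split => z; rewrite /xsection /A /cball/= inE.
Qed.

Lemma measurable_cball n (x : 'rV[R]_n) (r : R) : measurable (cball x r).
Proof.
rewrite -[cball x r]setTI; apply: measurable_fun_le => //.
have -> : (fun z : 'rV[R]_n => enorm (z - x)) =
  (fun p : 'rV[R]_n * 'rV[R]_n => enorm (p.2 - p.1)) \o (fun z : 'rV[R]_n => (x, z)) by [].
by apply: measurableT_comp; [exact: measurable_enormB|exact: measurable_pair1].
Qed.

Lemma continuous_enormB n (x : 'rV[R]_n) : continuous (fun z : 'rV[R]_n => enorm (z - x)).
Proof.
have cs (s : seq 'I_n) :
    continuous (fun w : 'rV[R]_n => \sum_(i <- s) (w - x) 0 i ^+ 2 : R).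
  have cx i : continuous (fun w : 'rV[R]_n => (w - x) 0 i : R).
    have -> : (fun w : 'rV[R]_n => (w - x) 0 i : R) =
        (fun w : 'rV[R]_n => w 0 i - x 0 i) by apply/funext => w; rewrite !mxE.
    by move=> w; apply: continuousB; [exact: coord_continuous|exact: cst_continuous].
  elim: s => [|i s ih].
    under eq_fun do rewrite big_nil.
    exact: cst_continuous.
  have -> : (fun w : 'rV[R]_n => \sum_(j <- i :: s) (w - x) 0 j ^+ 2 : R) =
      (fun w => (w - x) 0 i * (w - x) 0 i) \+
      (fun w => \sum_(j <- s) (w - x) 0 j ^+ 2).
    by apply/funext => w; rewrite big_cons expr2.
  by move=> w; apply: (@continuousD _ R^o); [apply: (@continuousM R); exact: cx|exact: ih].
by move=> z; apply: (@continuous_comp _ _ _ _ Num.sqrt);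
  [exact: cs|exact: sqrt_continuous].
Qed.

Lemma closed_cball n (x : 'rV[R]_n) (r : R) : closed (cball x r).
Proof.
apply: (@preimage_closed _ _ (fun z : 'rV[R]_n => enorm (z - x)) [set t | t <= r]).
  by move=> z _; exact: continuous_enormB.
exact: closed_le.
Qed.

Lemma closure_eball_sub n (x : 'rV[R]_n) (r : R) :
  closure (eball x r) `<=` cball x r.
Proof.
rewrite [X in _ `<=` X](closure_id _).1; last exact: closed_cball.
by apply: closureS => z /ltW.
Qed.

Lemma closure_eball n (x : 'rV[R]_n) (r : R) :
  0 < r -> closure (eball x r) = cball x r.
Proof.
move=> r0; apply/seteqP; split; first exact: closure_eball_sub.
move=> z zr B /nbhs_ballP[e /= e0 zB].
(* move z slightly towards the centre *)
pose d : R := Num.min 1 (e / (1 + `|x - z|)).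
have d0 : 0 < d by rewrite lt_min ltr01 divr_gt0// ltr_pwDl.
have d1 : d <= 1 by rewrite ge_min lexx.
exists (z + d *: (x - z)); split.
  rewrite /eball/=.
  have -> : z + d *: (x - z) - x = (1 - d) *: (z - x).
    by apply/rowP => i; rewrite !mxE; ring.
  rewrite enormZ ger0_norm ?subr_ge0//.
  apply: (@le_lt_trans _ _ ((1 - d) * r)); first by rewrite ler_wpM2l// subr_ge0.
  by rewrite mulrBl mul1r ltrBlDr ltrDl mulr_gt0.
apply: zB; rewrite -ball_normE/= opprD addrA subrr add0r normrN normrZ gtr0_norm//.
apply: (@le_lt_trans _ _ (e / (1 + `|x - z|) * `|x - z|)).
  by rewrite ler_wpM2r// ge_min lexx orbT.
by rewrite -mulrA gtr_pMr// ltr_pdivrMl ?ltr_pwDl// mulr1 ltrDr.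
Qed.

End closed_balls.

Section maximal_inequality.
Context {R : realType} {n : nat}.
Local Open Scope ereal_scope.
Implicit Types mu nu : {finite_measure set 'rV[R]_n -> \bar R}.

Lemma measure_seq_bigcup mu (I : eqType) (s : seq I) (B : I -> set 'rV[R]_n) A :
  measurable A -> (forall i, measurable (B i)) ->
  A `<=` [set x | exists2 i, i \in s & B i x] ->
  mu A <= \sum_(i <- s) mu (B i).
Proof.
move=> mA mB AB.
have {AB} AB : A `<=` \big[setU/set0]_(i <- s) B i.
  move=> x /AB[i si Bix]; elim: s {AB} si => // j s ih.
  rewrite inE big_cons => /predU1P[<-|/ih ?]; by [left|right].
have mU : measurable (\big[setU/set0]_(i <- s) B i) by exact: bigsetU_measurable.
apply: (le_trans (le_measure mu _ _ AB)); rewrite ?inE//.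
elim: s {AB mU} => [|i s ih]; first by rewrite !big_nil measure0.
rewrite !big_cons; apply: (le_trans (measureU2 _ _ _)) => //.
  exact: bigsetU_measurable.
exact: leeD.
Qed.

Lemma measure_overlap nu (I : eqType) (s : seq I) (B : I -> set 'rV[R]_n) (N : nat) :
  (forall i, measurable (B i)) ->
  (forall x, (count (fun i => `[< B i x >]) s <= N)%N) ->
  \sum_(i <- s) nu (B i) <= N%:R%:E * nu setT.
Proof.
move=> mB BN.
apply: (@le_trans _ _ (\int[nu]_x (\sum_(i <- s) (\1_(B i) x)%:E)%E)).
  rewrite ge0_integral_sum//.
    by apply: lee_sum => i _; rewrite integral_indic// setIT.
  by move=> i; apply/measurable_EFinP; exact: measurable_indic.
rewrite -(integral_cst nu measurableT N%:R%:E).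
apply: ge0_le_integral => //.
- by move=> x _; apply: sume_ge0 => i _; rewrite lee_fin.
- by apply: emeasurable_sum => i; apply/measurable_EFinP; exact: measurable_indic.
- move=> x _ /=; rewrite sumEFin lee_fin.
  have -> : (\sum_(i <- s) \1_(B i) x)%R = (count (fun i => `[< B i x >]) s)%:R :> R.
    elim: s {BN} => [|i s ih]; first by rewrite big_nil.
    by rewrite big_cons/= natrD ih indicE; congr (_%:R + _)%R.
  by rewrite ler_nat.
Qed.

End maximal_inequality.

(** * The maximal inequality and its almost-everywhere consequence *)

Section differentiation.
Context {R : realType} {n : nat}.
Local Open Scope ereal_scope.
Implicit Types mu nu : {finite_measure set 'rV[R]_n -> \bar R}.

Lemma finite_radii_maximal_inequality : exists N : nat,
  forall mu nu (t b : R) (A : set 'rV[R]_n) (l : seq R),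
    (0 < t)%R -> measurable A -> (forall x, A x -> (enorm x <= b)%R) ->
    all (fun r => 0 < r)%R l ->
    (forall x, A x -> exists2 r, r \in l &
      t%:E * mu (cball x r) <= nu (cball x r)) ->
    t%:E * mu A <= N%:R%:E * nu setT.
Proof.
have [N HN] := @sepballs_overlap R n.
exists N => mu nu t b A l t0 mA Ab l0 Al.
pose V (r : R) := [set x | A x /\ t%:E * mu (cball x r) <= nu (cball x r)].
have [|s [ssep sV scov]] := @besicovitch_cover R n b l V l0.
  by move=> r x [/Ab].
pose B (p : 'rV[R]_n * R) := cball p.1 p.2.
have muA : mu A <= \sum_(p <- s) mu (B p).
  apply: measure_seq_bigcup => // [p|x Ax]; first exact: measurable_cball.
  by have [r rl tr] := Al _ Ax; exact: (scov r x rl (conj Ax tr)).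
have le1 : t%:E * mu A <= t%:E * \sum_(p <- s) mu (B p).
  by apply: lee_wpmul2l => //; rewrite lee_fin ltW.
apply: (le_trans le1); rewrite ge0_sume_distrr//.
apply: (@le_trans _ _ (\sum_(p <- s) nu (B p))).
  by rewrite big_seq [leRHS]big_seq; apply: lee_sum => p /sV[_ []].
apply: measure_overlap => [p|x]; first exact: measurable_cball.
rewrite (leq_trans _ (HN _ x ssep))//; apply: sub_count => p.
by move=> /asboolP.
Qed.

(** The points having a ball of positive rational radius on which [nu] exceeds
    [t * mu]. *)
Definition heavy mu nu (t : R) : set 'rV[R]_n := [set x | exists q : rat,
  (0 < ratr q :> R)%R /\ t%:E * mu (cball x (ratr q)) < nu (cball x (ratr q))].

Let heavy_at mu nu (t : R) (q : rat) : set 'rV[R]_n :=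
  [set x | (0 < ratr q :> R)%R /\
           t%:E * mu (cball x (ratr q)) < nu (cball x (ratr q))].

Let measurable_heavy_at mu nu t q : measurable (heavy_at mu nu t q).
Proof.
have [q0|q0] := ltP (0 : R)%R (ratr q); last first.
  rewrite (_ : heavy_at _ _ _ _ = set0)//.
  by apply/seteqP; split => // x [+ _]; rewrite ltNge q0.
rewrite (_ : heavy_at _ _ _ _ = setT `&`
   [set x | t%:E * mu (cball x (ratr q)) < nu (cball x (ratr q))]).
  apply: emeasurable_fun_lt => //; last exact: measurable_cball_measure.
  by apply: measurable_funeM; exact: measurable_cball_measure.
by rewrite setTI; apply/seteqP; split => x; [case|split].
Qed.

Lemma measurable_heavy mu nu t : measurable (heavy mu nu t).
Proof.
rewrite (_ : heavy _ _ _ = \bigcup_q heavy_at mu nu t q).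
  by apply: bigcupT_measurable_rat => q; exact: measurable_heavy_at.
by apply/seteqP; split => x; [case=> q ?; exists q|case=> q _ ?; exists q].
Qed.

(** The sets [F k], where the centre has norm at most [k] and one of the first
    [k] rational radii is used, increase to the heavy set. *)
Lemma maximal_inequality : exists N : nat, forall mu nu (t : R),
  (0 < t)%R -> t%:E * mu (heavy mu nu t) <= N%:R%:E * nu setT.
Proof.
have [N HN] := finite_radii_maximal_inequality.
exists N => mu nu t t0.
(* an enumeration of the rationals; codes of no rational are sent to 0, which
   is not a positive radius *)
pose e (k : nat) : rat := odflt 0%R (unpickle k).
pose F (k : nat) : set 'rV[R]_n := [set x | (enorm x <= k%:R)%R] `&`
  \bigcup_(i in `I_k) heavy_at mu nu t (e i).
have mF k : measurable (F k).
  apply: measurableI.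
    have -> : [set x : 'rV[R]_n | (enorm x <= k%:R)%R] = cball 0 k%:R.
      by apply/seteqP; split => x; rewrite /cball/= subr0.
    exact: measurable_cball.
  by apply: bigcup_measurable => i _; exact: measurable_heavy_at.
have -> : heavy mu nu t = \bigcup_k F k.
  apply/seteqP; split => [x [q qx]|x [k _ [_ [i _ hx]]]]; last by exists (e i).
  pose k := maxn (Num.truncn (enorm x)).+1 (pickle q).+1.
  exists k => //; split.
    apply/ltW/(lt_le_trans (truncnS_gt _)).
    by rewrite ler_nat leq_maxl.
  by exists (pickle q); [exact: leq_maxr|rewrite /e pickleK].
have ndF : nondecreasing_seq F.
  move=> i j ij; apply/subsetPset => x [xi [k ki hx]]; split.
    by rewrite /= (le_trans xi)// ler_nat.
  by exists k => //; exact: (leq_trans ki).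
have cF : mu \o F @ \oo --> mu (\bigcup_k F k).
  by apply: nondecreasing_cvg_mu => //; exact: bigcupT_measurable.
have ctF : t%:E * mu (F k) @[k --> \oo] --> t%:E * mu (\bigcup_k F k).
  by apply: (cvgeZl _ cF).
rewrite -(cvg_lim _ ctF)//.
apply: lime_le; first by apply/cvg_ex; exists (t%:E * mu (\bigcup_k F k)).
near=> k.
apply: (HN mu nu t k%:R (F k)
  [seq ratr (e i) | i <- iota 0 k & (0 < ratr (e i) :> R)%R]) => //.
- by move=> x [].
- by rewrite all_map; apply/allP => i /=; rewrite mem_filter => /andP[].
- move=> x [_ [i ik [i0 ix]]]; exists (ratr (e i)); last exact: ltW.
  by apply/mapP; exists i => //; rewrite mem_filter i0 mem_iota add0n.
Unshelve. all: by end_near. Qed.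

(** Rational radii suffice, since the measure of a closed ball is continuous
    from the right in its radius. *)
Lemma not_heavy_le mu nu t x (r : R) : (0 < t)%R -> (0 < r)%R ->
  ~ heavy mu nu t x -> nu (cball x r) <= t%:E * mu (cball x r).
Proof.
move=> t0 r0 nh.
pose F (k : nat) := cball x (r + k.+1%:R^-1).
have capF : \bigcap_k F k = cball x r.
  apply/seteqP; split => z zF.
    apply/ler_addgt0Pr => e e0.
    have [k ke] : exists k : nat, (k.+1%:R^-1 <= e)%R.
      exists (Num.truncn e^-1); rewrite -[leRHS]invrK lef_pV2 ?posrE ?invr_gt0//.
      exact/ltW/truncnS_gt.
    by apply: (le_trans (zF k _)) => //; rewrite lerD2l.
  by move=> k _; apply: cball_le zF; rewrite lerDl.
have cF : mu \o F @ \oo --> mu (cball x r).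
  rewrite -capF; apply: nonincreasing_cvg_mu => //.
  - by rewrite ltey_eq fin_num_measure//; exact: measurable_cball.
  - by move=> k; exact: measurable_cball.
  - by rewrite capF; exact: measurable_cball.
  - move=> i j ij; apply/subsetPset; apply: cball_le.
    by rewrite lerD2l lef_pV2 ?posrE// ler_nat.
have ctF : t%:E * mu (F k) @[k --> \oo] --> t%:E * mu (cball x r).
  by apply: (cvgeZl _ cF).
rewrite -(cvg_lim _ ctF)//.
apply: lime_ge; first by apply/cvg_ex; exists (t%:E * mu (cball x r)).
near=> k.
have /rat_in_itvoo[q] : (r < r + k.+1%:R^-1)%R by rewrite ltrDl.
rewrite in_itv/= => /andP[rq qk].
apply: (@le_trans _ _ (nu (cball x (ratr q)))).
  apply: le_measure; rewrite ?inE; [exact: measurable_cball..|].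
  exact/cball_le/ltW.
apply: (@le_trans _ _ (t%:E * mu (cball x (ratr q)))).
  by rewrite leNgt; apply/negP => h; apply: nh; exists q; split => //; exact: lt_trans rq.
apply: lee_wpmul2l; first by rewrite lee_fin ltW.
by apply: le_measure; rewrite ?inE; [exact: measurable_cball..|apply/cball_le/ltW].
Unshelve. all: by end_near. Qed.

(** If near each point of [X] the functions [f x] are dominated by measures of
    arbitrarily small mass, they are negligible with respect to [mu] on small
    balls around [mu]-almost every point of [X]. *)
Lemma small_domination_ae mu (X : set 'rV[R]_n) (f : 'rV[R]_n -> R -> \bar R) :
  (forall e : R, (0 < e)%R ->
    exists2 nu : {finite_measure set 'rV[R]_n -> \bar R}, nu setT < e%:E &
    forall x, X x -> \forall r \near (0:R)^'+, f x r <= nu (cball x r)) ->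
  \forall x \ae mu, X x -> forall t : R, (0 < t)%R ->
    \forall r \near (0:R)^'+, f x r <= t%:E * mu (cball x r).
Proof.
move=> Xf; have [N HN] := maximal_inequality.
pose T (j : nat) : R := (j.+1%:R^-1)%R.
have T0 j : (0 < T j)%R by rewrite invr_gt0.
have /choice[nu nuP] (p : nat * nat) :
    exists nu : {finite_measure set 'rV[R]_n -> \bar R}, nu setT < (T p.1 * T p.2)%:E /\
    forall x, X x -> \forall r \near (0:R)^'+, f x r <= nu (cball x r).
  by have [|v v1 v2] := Xf (T p.1 * T p.2)%R; [exact: mulr_gt0|exists v].
pose H j i := heavy mu (nu (j, i)) (T j).
have mH j i : measurable (H j i) by exact: measurable_heavy.
pose M := \bigcup_j \bigcap_i H j i.
have mM0 j : measurable (\bigcap_i H j i) by exact: bigcapT_measurable.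
have muH j i : mu (H j i) <= (N%:R * T i)%:E.
  have h := HN mu (nu (j, i)) (T j) (T0 j).
  have {}h : (T j)%:E * mu (H j i) <= (T j)%:E * (N%:R * T i)%:E.
    apply: (le_trans h); rewrite -EFinM mulrCA EFinM; apply: lee_wpmul2l.
      by rewrite lee_fin.
    exact: (ltW (nuP (j, i)).1).
  by move: h; rewrite lee_pmul2l ?lte_fin.
exists M; split.
- by apply: bigcupT_measurable => j; exact: mM0.
- apply/eqP; rewrite -measure_le0.
  apply: (le_trans (generalized_Boole_inequality _ mM0 _)).
    by apply: bigcupT_measurable => j; exact: mM0.
  rewrite eseries0// => j _ _; apply/eqP; rewrite -measure_le0.
  apply/lee_addgt0Pr => e e0; rewrite add0e.
  have [i ie] : exists i : nat, (N%:R * T i <= e)%R.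
    exists (Num.truncn (N%:R / e)%R); rewrite /T ler_pdivrMr//.
    by rewrite mulrC -ler_pdivrMr// ltW// truncnS_gt.
  apply: (@le_trans _ _ (mu (H j i))).
    by apply: le_measure; rewrite ?inE//; exact: bigcap_inf.
  by apply: (le_trans (muH j i)); rewrite lee_fin.
- move=> x /=; apply: contra_notP => nM Xx t t0.
  have [j jt] : exists j : nat, (T j <= t)%R.
    exists (Num.truncn t^-1); rewrite /T -[leRHS]invrK lef_pV2 ?posrE ?invr_gt0//.
    exact/ltW/truncnS_gt.
  have [i nH] : exists i, ~ H j i x.
    apply/existsNP => hx; apply: nM; exists j => // i _; exact: hx.
  near=> r.
  have r0 : (0 < r)%R by near: r; exact: nbhs_right_gt.
  apply: (@le_trans _ _ (nu (j, i) (cball x r))).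
    by near: r; exact: (nuP (j, i)).2.
  apply: (le_trans (not_heavy_le _ _ _ _ _ (T0 j) r0 nH)).
  by apply: lee_wpmul2r => //; rewrite lee_fin.
Unshelve. all: by end_near. Qed.

End differentiation.

(** * Outer regularity of finite measures *)

Section regularity.
Local Open Scope ereal_scope.
Context {d} {T : measurableType d} {R : realType}.
Variable lambda : {finite_measure set T -> \bar R}.
(* [O] plays the role of the measurable open sets *)
Variable O : set (set T).
Hypothesis Om : O `<=` measurable.
Hypothesis O0 : O set0.
Hypothesis OT : O setT.
Hypothesis OI : forall A B, O A -> O B -> O (A `&` B).
Hypothesis Ocup : forall F : (set T)^nat, (forall i, O (F i)) -> O (\bigcup_i F i).

(** [A] is squeezed, up to small measure, between an open set [U] and a closed
    set, given as the complement of an open set [V]. *)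
Definition regular_set (A : set T) := forall e : R, (0 < e)%R ->
  exists U V, [/\ O U, O V, ~` V `<=` A, A `<=` U & lambda (U `&` V) < e%:E].

Lemma regular_setC A : regular_set A -> regular_set (~` A).
Proof.
move=> rA e /rA[U [V [OU OV VA AU UVe]]]; exists V, U; split => //.
- exact: subsetC.
- by rewrite -[V]setCK; exact: subsetC.
- by rewrite setIC.
Qed.

(** By continuity from above, a countable union of closed sets almost filling
    [U] can be replaced by a finite one, whose complement [W] is open. *)
Let finite_capture (U : set T) (V : (set T)^nat) (e : R) : O U ->
  (forall k, O (V k)) -> lambda (U `&` \bigcap_k V k) < e%:E ->
  exists W, [/\ O W, ~` W `<=` \bigcup_k ~` V k & lambda (U `&` W) < e%:E].
Proof.
move=> OU OV le.
pose W (n : nat) := \bigcap_(k in `I_n) V k.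
have OW n : O (W n).
  elim: n => [|n ih]; first by rewrite /W II0 bigcap_set0.
  by rewrite /W IIS bigcap_setU bigcap_set1; exact: OI.
have mUW n : measurable (U `&` W n) by apply/Om/OI.
have capE : \bigcap_n (U `&` W n) = U `&` \bigcap_k V k.
  apply/seteqP; split => [x UW|x [Ux Vx] n _]; last by split => // k _; exact: Vx.
  split; first by have [] := UW 0%N Logic.I.
  by move=> k _; have [_] := UW k.+1 Logic.I; apply => /=.
have cW : lambda \o (fun n => U `&` W n) @ \oo --> lambda (U `&` \bigcap_k V k).
  rewrite -capE; apply: nonincreasing_cvg_mu => //.
  - by rewrite ltey_eq fin_num_measure.
  - exact: bigcapT_measurable.
  - move=> i j ij; apply/subsetPset => x [Ux Wx]; split => // k ki.
    by apply: Wx; exact: leq_trans ij.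
have [n ne] : exists n, lambda (U `&` W n) < e%:E.
  apply: contrapT => /forallNP ge; move: le; apply/negP; rewrite -leNgt.
  apply: (cvge_ge _ cW); near=> n.
  by rewrite leNgt; apply/negP; exact: ge.
exists (W n); split => // x.
by rewrite /W setC_bigcap => -[k _ ?]; exists k.
Unshelve. all: by end_near. Qed.

Lemma regular_open_Fsigma U (V : (set T)^nat) : O U -> (forall k, O (V k)) ->
  U = \bigcup_k ~` V k -> regular_set U.
Proof.
move=> OU OV UV e e0.
have [|W [OW WV We]] := finite_capture U V e OU OV.
  rewrite UV (_ : _ `&` _ = set0) ?measure0//.
  by apply/seteqP; split => // x [[k _ nV] /(_ k Logic.I)].
by exists U, W; split => //; rewrite UV.
Qed.

Lemma regular_bigcup (A : (set T)^nat) :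
  (forall i, regular_set (A i)) -> regular_set (\bigcup_i A i).
Proof.
move=> rA e e0.
have e2 : (0 < e / 2)%R by rewrite divr_gt0.
have /choice[UV UVP] (i : nat) : exists UV : set T * set T,
    [/\ O UV.1, O UV.2, ~` UV.2 `<=` A i, A i `<=` UV.1 &
        lambda (UV.1 `&` UV.2) < (e / 2 / (2 ^ i.+1)%:R)%:E].
  have [|U [V [? ? ? ? ?]]] := rA i (e / 2 / (2 ^ i.+1)%:R)%R.
    by rewrite divr_gt0// ltr0n expn_gt0.
  by exists (U, V).
pose U i := (UV i).1; pose V i := (UV i).2.
have OU i : O (U i) by have [] := UVP i.
have OV i : O (V i) by have [] := UVP i.
have OUU : O (\bigcup_i U i) by exact: Ocup.
have mUV i : measurable (U i `&` V i) by exact/Om/OI.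
have [|W [OW WV We]] := finite_capture (\bigcup_i U i) V e OUU OV.
  apply: (@le_lt_trans _ _ (e / 2)%:E); last first.
    by rewrite lte_fin ltr_pdivrMr// ltr_pMr// ltr1n.
  apply: (@le_trans _ _ (lambda (\bigcup_i (U i `&` V i)))).
    apply: le_measure; rewrite ?inE.
    - by apply: measurableI; [exact: Om|apply: bigcapT_measurable => i; exact: Om].
    - exact: bigcupT_measurable.
    - by move=> x [[i _ Ux] Vx]; exists i => //; split => //; exact: Vx.
  apply: (le_trans (generalized_Boole_inequality _ mUV _)).
    exact: bigcupT_measurable.
  apply: le_trans (epsilon_trick0 _ _) => //; last exact: ltW.
  by apply: lee_nneseries => // i _ ; have [_ _ _ _ /ltW] := UVP i.
exists (\bigcup_i U i), W; split => //.
- by apply: (subset_trans WV); apply: subset_bigcup => i _; have [] := UVP i.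
- by apply: subset_bigcup => i _; have [] := UVP i.
Qed.

Lemma sigma_algebra_regular : sigma_algebra setT regular_set.
Proof.
split => [|A rA|]; [|by rewrite setTD; exact: regular_setC|exact: regular_bigcup].
rewrite -setCT; apply: regular_setC.
apply: (regular_open_Fsigma _ (fun=> set0)) => //.
by rewrite setC0 bigcup_const//; exists 0%N.
Qed.

Lemma regular_null_cover A (e : R) : regular_set A -> measurable A ->
  lambda A = 0 -> (0 < e)%R ->
  exists U, [/\ O U, A `<=` U & lambda U < e%:E].
Proof.
move=> rA mA A0 /rA[U [V [OU OV VA AU UVe]]]; exists U; split => //.
apply: le_lt_trans UVe.
have mUV : measurable (U `&` V) by exact/Om/OI.
apply: (@le_trans _ _ (lambda ((U `&` V) `|` A))).
  apply: le_measure; rewrite ?inE; [exact: Om|exact: measurableU|].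
  by move=> x Ux; have [Vx|nV] := pselect (V x); [left|right; exact: VA].
have : lambda ((U `&` V) `|` A) <= lambda (U `&` V) + lambda A.
  exact: measureU2.
by rewrite A0 adde0.
Qed.

End regularity.

Section euclidean_regularity.
Local Open Scope ereal_scope.
Context {R : realType}.

Lemma open_Fsigma {T : pseudoMetricType R} (U : set T) : open U ->
  exists V : (set T)^nat, (forall k, open (V k)) /\ U = \bigcup_k ~` V k.
Proof.
move=> oU.
pose V k := \bigcup_(y in ~` U) (ball y (k.+1%:R^-1 : R)%R)^°.
have k0 k : (0 < k.+1%:R^-1 :> R)%R by rewrite invr_gt0.
exists V; split.
  by move=> k; apply: bigcup_open => y _; exact: open_interior.
apply/seteqP; split => [x Ux|x [k _ nV]].
  have /nbhs_ballP[e /= e0 xU] : nbhs x U by exact: open_nbhs_nbhs.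
  exists (Num.truncn e^-1) => // -[y nUy /interior_subset yx].
  apply: nUy; apply: xU; apply: ball_sym; apply: le_ball yx.
  rewrite -[leRHS]invrK lef_pV2 ?posrE ?invr_gt0//.
  exact/ltW/truncnS_gt.
apply: contrapT => nUx; apply: nV; exists x => //.
exact: nbhsx_ballx.
Qed.

Lemma outer_regular_rV n (lambda : {finite_measure set 'rV[R]_n -> \bar R})
    (A : set 'rV[R]_n) (e : R) :
  measurable A -> lambda A = 0 -> (0 < e)%R ->
  exists U, [/\ open U, A `<=` U & lambda U < e%:E].
Proof.
move=> mA A0 e0; pose O : set (set 'rV[R]_n) := open.
have Om : O `<=` measurable by move=> B; exact: open_measurable_rV.
have O0 : O set0 by exact: open0.
have OT : O setT by exact: openT.
have OI B C : O B -> O C -> O (B `&` C) by exact: openI.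
have Ocup (F : (set 'rV[R]_n)^nat) :
  (forall i, O (F i)) -> O (\bigcup_i F i).
  by move=> OF; apply: bigcup_open => i _; exact: OF.
apply: (regular_null_cover lambda O Om OI) => //.
move: A mA {A0}; apply: smallest_sub; first exact: (sigma_algebra_regular lambda O Om O0 OT OI Ocup).
move=> B oB; have [V [oV BV]] := open_Fsigma B oB.
exact: (regular_open_Fsigma lambda O Om OT OI B V).
Qed.

(** The sets considered in the product are both open and measurable for the
    product of the Borel sigma-algebras. *)
Lemma outer_regular_prod n m
    (lambda : {finite_measure set ('rV[R]_n * 'rV[R]_m)%type -> \bar R})
    (A : set ('rV[R]_n * 'rV[R]_m)%type) (e : R) :
  measurable A -> lambda A = 0 -> (0 < e)%R ->
  exists U : set ('rV[R]_n * 'rV[R]_m)%type, [/\ open U, measurable U, A `<=` U & lambda U < e%:E].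
Proof.
move=> mA A0 e0.
pose O : set (set ('rV[R]_n * 'rV[R]_m)%type) := 
  [set B : set ('rV[R]_n * 'rV[R]_m)%type | open B /\ measurable B].
have Om : O `<=` measurable by move=> B [].
have O0 : O set0 by split; [exact: open0|exact: measurable0].
have OT : O setT by split; [exact: openT|exact: measurableT].
have OI B C : O B -> O C -> O (B `&` C).
  by move=> [? ?] [? ?]; split; [exact: openI|exact: measurableI].
have Ocup (F : (set ('rV[R]_n * 'rV[R]_m)%type)^nat) :
    (forall i, O (F i)) -> O (\bigcup_i F i).
  move=> OF; split; first by apply: bigcup_open => i _; exact: (OF i).1.
  by apply: bigcupT_measurable => i; exact: (OF i).2.
have sreg := sigma_algebra_regular lambda O Om O0 OT OI Ocup.
suff rA : regular_set lambda O A.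
  by have [U [[? ?] ? ?]] := regular_null_cover lambda O Om OI A e rA mA A0 e0;
    exists U.
have pre p (f : 'rV[R]_n * 'rV[R]_m -> 'rV[R]_p) : continuous f ->
    measurable_fun setT f ->
    forall B, measurable B -> regular_set lambda O (f @^-1` B).
  move=> /continuousP cf mf.
  have Of B : open B -> O (f @^-1` B).
    move=> oB; split; first exact: cf.
    by rewrite -[X in measurable X]setTI; apply: mf => //; exact: open_measurable_rV.
  apply: smallest_sub.
    have [s0 sC sU] := sreg; split.
    - by rewrite /= preimage_set0.
    - by move=> B /sC; rewrite !setTD.
    - by move=> F /sU; rewrite /= preimage_bigcup.
  move=> B oB; have [V [oV BV]] := open_Fsigma B oB.
  apply: (regular_open_Fsigma lambda O Om OT OI _ (fun k => f @^-1` V k)).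
  - exact: Of.
  - by move=> k; exact: Of.
  - by rewrite [in LHS]BV preimage_bigcup.
move: A mA {A0}; apply: smallest_sub => // B [[C mC <-]|[C mC <-]]; rewrite setTI.
- by apply: pre => // x; exact: cvg_fst.
- by apply: pre => // x; exact: cvg_snd.
Qed.

End euclidean_regularity.

(** * Measures near the graph: hulls, fibres and shrinking cylinders *)

Section auxiliary_measures.
Local Open Scope ereal_scope.
Context {R : realType}.

(** The projection to the first factor of the restriction of [lambda] to [G]. *)
Lemma fiber_measure {d1 d2} {T1 : measurableType d1} {T2 : measurableType d2}
    (lambda : {finite_measure set (T1 * T2)%type -> \bar R})
    (G : set (T1 * T2)) : measurable G ->
  exists nu : {finite_measure set T1 -> \bar R},
    forall B, nu B = lambda ((fst @^-1` B) `&` G).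
Proof.
move=> mG.
pose P := @measure_function_pushforward__canonical__measure_function_Measure
  _ _ _ _ _ (mrestr lambda mG) _ (@measurable_fst _ _ T1 T2).
have Pfin : fin_num_fun P.
  move=> A mA; rewrite /P/= /pushforward /mrestr; apply: fin_num_measure.
  apply: measurableI => //.
  by rewrite -[X in measurable X]setTI; apply: measurable_fst.
exists (HB.pack_for {finite_measure set T1 -> \bar R}
    (Measure.sort P) (Measure_isFinite.Build _ _ _ (Measure.sort P) Pfin)).
by [].
Qed.

(** The total variation of a charge, as a finite measure. *)
Lemma charge_total_variation {d} {T : measurableType d}
    (lambda : {charge set T -> \bar R}) :
  exists V : {finite_measure set T -> \bar R},
    (forall A, measurable A -> `|lambda A| <= V A) /\
    (forall N, measurable N -> lambda.-null_set N -> V N = 0).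
Proof.
have [P [N PN]] := Hahn_decomposition lambda.
have [[mP _] [mN _] _ _] := PN.
pose W : {measure set T -> \bar R} := charge_variation PN.
have Wfin : fin_num_fun W.
  by move=> A mA; rewrite /W/= /charge_variation fin_numD !fin_num_measure.
exists (HB.pack_for {finite_measure set T -> \bar R}
    (Measure.sort W) (Measure_isFinite.Build _ _ _ (Measure.sort W) Wfin)).
split => [A mA|A mA A0]; first exact: abse_charge_variation.
rewrite /= /charge_variation jordan_posE cjordan_posE jordan_negE cjordan_negE.
rewrite /crestr0 !mem_set// /crestr.
have l0 B : measurable B -> lambda (A `&` B) = 0.
  by move=> mB; apply: A0; [exact: measurableI|exact: subIsetl].
by rewrite !l0// oppe0 adde0.
Qed.

(** Every set has a measurable hull for the outer measure. *)
Lemma measurable_hull {d} {T : measurableType d}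
    (mu : {finite_measure set T -> \bar R}) (X : set T) :
  exists H, [/\ measurable H, X `<=` H & mu H = (mu^*)%mu X].
Proof.
have Xfin : (mu^*)%mu X \is a fin_num.
  rewrite ge0_fin_numE ?mu_ext_ge0//.
  apply: (@le_lt_trans _ _ ((mu^*)%mu setT)); first exact: le_mu_ext.
  by rewrite measurable_mu_extE// ltey_eq fin_num_measure.
have /choice[H HP] (k : nat) : exists H, [/\ measurable H, X `<=` H &
    mu H <= (mu^*)%mu X + k.+1%:R^-1%:E].
  have k0 : (0 < k.+1%:R^-1 :> R)%R by rewrite invr_gt0.
  have /(lb_ereal_inf_adherent k0)[_ [B [mB XB] <-] Blt] := Xfin.
  exists (\bigcup_i B i); split => //; first exact: bigcupT_measurable.
  apply: le_trans (ltW Blt).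
  by apply: generalized_Boole_inequality => //; exact: bigcupT_measurable.
have mH k : measurable (H k) by have [] := HP k.
have mcap : measurable (\bigcap_k H k) by exact: bigcapT_measurable.
exists (\bigcap_k H k); split => //.
  by move=> x Xx k _; have [_ XH _] := HP k; exact: XH.
apply/eqP; rewrite eq_le; apply/andP; split; last first.
  rewrite -measurable_mu_extE//; apply: le_mu_ext => x Xx k _.
  by have [_ XH _] := HP k; exact: XH.
apply/lee_addgt0Pr => e e0.
have [k ke] : exists k : nat, (k.+1%:R^-1 <= e)%R.
  exists (Num.truncn e^-1); rewrite -[leRHS]invrK lef_pV2 ?posrE ?invr_gt0//.
  exact/ltW/truncnS_gt.
apply: (@le_trans _ _ (mu (H k))).
  by apply: le_measure; rewrite ?inE//; exact: bigcap_inf.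
have [_ _ /le_trans] := HP k; apply.
by apply: leeD => //; rewrite lee_fin.
Qed.

End auxiliary_measures.

Section cylinders.
Context {R : realType}.

Lemma closureX {T U : topologicalType} (A : set T) (B : set U) :
  closure (A `*` B) = closure A `*` closure B.
Proof.
apply/seteqP; split => [[x y] xy|[x y] [/= Ax By] C [[P Q] [/= Px Qy] PQ]].
  split=> /= P nP.
    have [[a b] [[/= Aa _] Pa]] : (A `*` B) `&` (fst @^-1` P) !=set0.
      by apply: xy; exists (P, setT); [split=> //; exact: filterT|move=> ? []].
    by exists a.
  have [[a b] [[/= _ Bb] Pb]] : (A `*` B) `&` (snd @^-1` P) !=set0.
    by apply: xy; exists (setT, P); [split=> //; exact: filterT|move=> ? []].
  by exists b.
have [a [Aa Pa]] := Ax _ Px; have [b [Bb Qb]] := By _ Qy.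
by exists (a, b); split; [split|exact: PQ].
Qed.

Lemma measurable_closed_cylinder n m (x : 'rV[R]_n) (r : R) (y : 'rV[R]_m) (c : R) :
  measurable (closed_cylinder x r y c).
Proof.
rewrite /closed_cylinder closureX.
by apply: measurableX; apply: closed_measurable_rV; exact: closed_closure.
Qed.

Lemma closed_cylinder_sub n m (x : 'rV[R]_n) (r : R) (y : 'rV[R]_m) (c : R) :
  closed_cylinder x r y c `<=` cball x r `*` cball y c.
Proof.
rewrite /closed_cylinder closureX => p [px py].
by split; exact: closure_eball_sub.
Qed.

Lemma near_closed_cylinder_sub n m (x : 'rV[R]_n) (v : 'rV[R]_m)
    (y : R -> 'rV[R]_m) (c : R -> R) (U : set ('rV[R]_n * 'rV[R]_m)%type) :
  open U -> U (x, v) -> c r @[r --> 0^'+] --> (0 : R) ->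
  y r @[r --> 0^'+] --> v ->
  \forall r \near (0 : R)^'+, closed_cylinder x r (y r) (c r) `<=` U.
Proof.
move=> oU Uxv c0 yv.
have /nbhs_ballP[e /= e0 eU] : nbhs (x, v) U by exact: open_nbhs_nbhs.
near=> r => p /closed_cylinder_sub[px py]; apply: eU.
have re : r < e by near: r; exact: nbhs_right_lt.
have ce : c r < e / 2.
  by near: r; apply: (cvgr_lt 0) => //; rewrite divr_gt0.
have ye : ball v (e / 2) (y r).
  by near: r; apply: (cvg_ball yv); rewrite divr_gt0.
split; split => //= i j; rewrite ord1 /ball /= distrC.
  apply: le_lt_trans re; apply: le_trans px.
  by have := normr_coord_le_enorm (p.1 - x) j; rewrite !mxE.
case: ye => _ /(_ 0 j); rewrite /ball/= => ye.
have := normr_coord_le_enorm (p.2 - y r) j; rewrite !mxE => h.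
rewrite -(subrKA (y r 0 j)) (le_lt_trans (ler_normD _ _))//.
rewrite [ltRHS]splitr; apply: ltrD; last by rewrite distrC.
exact: (le_lt_trans (le_trans h py)).
Unshelve. all: by end_near. Qed.

End cylinders.

Section singular_part.
Context {R : realType} {n m : nat}.
Local Open Scope ereal_scope.
Variable mu : {finite_measure set 'rV[R]_n -> \bar R}.
Variables (Omega : set 'rV[R]_n) (u : 'rV[R]_n -> 'rV[R]_m).
Variables (c : 'rV[R]_n -> R -> R) (y : 'rV[R]_n -> R -> 'rV[R]_m).
Hypothesis c_cvg : forall x, Omega x -> c x r @[r --> 0^'+] --> (0 : R)%R.
Hypothesis y_cvg : forall x, Omega x -> y x r @[r --> 0^'+] --> u x.

(** The cylinders shrink to the point [(x, u x)] of [N], hence eventually lie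
    in any open neighbourhood of [N]. *)
Lemma cylinder_null_ae (lambda : {charge set ('rV[R]_n * 'rV[R]_m)%type -> \bar R})
    (N : set ('rV[R]_n * 'rV[R]_m)%type) :
  measurable N -> lambda.-null_set N ->
  \forall x \ae mu, Omega x -> N (x, u x) -> forall t : R, (0 < t)%R ->
    \forall r \near (0 : R)^'+,
      `|lambda (closed_cylinder x r (y x r) (c x r))| <= t%:E * mu (cball x r).
Proof.
move=> mN lN; have [V [lV V0]] := charge_total_variation lambda.
suff : \forall x \ae mu, [set x | Omega x /\ N (x, u x)] x ->
    forall t : R, (0 < t)%R -> \forall r \near (0 : R)^'+,
      `|lambda (closed_cylinder x r (y x r) (c x r))| <= t%:E * mu (cball x r).
  by apply: filterS => x h Ox Nx; exact: h.
apply: (small_domination_ae mu _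
  (fun x r => `|lambda (closed_cylinder x r (y x r) (c x r))|)).
move=> e e0.
have [U [oU mU NU Ue]] := outer_regular_prod n m V N e mN (V0 N mN lN) e0.
have [nu nuE] := fiber_measure V U mU.
exists nu; first by rewrite nuE preimage_setT setTI.
move=> x [Ox Nx].
have Ux : U (x, u x) by exact: NU.
have := near_closed_cylinder_sub n m x (u x) (y x) (c x) U oU Ux
  (c_cvg x Ox) (y_cvg x Ox).
apply: filterS => r rU.
have mcyl := measurable_closed_cylinder n m x r (y x r) (c x r).
apply: (le_trans (lV _ mcyl)); rewrite nuE.
apply: le_measure; rewrite ?inE//.
  apply: measurableI => //; rewrite -[X in measurable X]setTI.
  by apply: measurable_fst => //; exact: measurable_cball.
by move=> p pc; split; [have [] := closed_cylinder_sub n m _ _ _ _ _ pc|exact: rU].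
Qed.

End singular_part.

(** * Graphical measures *)

Section graphical_measure_facts.
Local Open Scope ereal_scope.
Context {R : realType} {n m : nat}.
Variables (mu : {finite_measure set 'rV[R]_n -> \bar R}) (u : 'rV[R]_n -> 'rV[R]_m).
Variable eta : {finite_measure set ('rV[R]_n * 'rV[R]_m)%type -> \bar R}.
Hypothesis etaP : is_graphical_measure mu u eta.

Lemma graphical_measureE E : measurable E ->
  eta E = (mu^*)%mu [set x | E (x, u x)].
Proof. by move=> mE; rewrite etaP. Qed.

Lemma graphical_measure_fst A : measurable A -> eta (fst @^-1` A) = mu A.
Proof.
move=> mA; rewrite graphical_measureE; first exact: measurable_mu_extE.
by rewrite -[X in measurable X]setTI; exact: measurable_fst.
Qed.

(** As [eta] is additive, the outer measures of [E] and of its complement, both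
    pulled back along the graph, add up to the total mass. *)
Lemma graph_preimage_borel E : measurable E ->
  exists E' Z, [/\ measurable E', measurable Z, mu Z = 0,
    forall x, E' x -> E (x, u x) & forall x, E (x, u x) -> E' x \/ Z x].
Proof.
move=> mE.
have [H1 [mH1 EH1 muH1]] := measurable_hull mu [set x | E (x, u x)].
have [H2 [mH2 EH2 muH2]] := measurable_hull mu [set x | (~` E) (x, u x)].
have mEC : measurable (~` E) by exact: measurableC.
rewrite -graphical_measureE// in muH1.
rewrite -(graphical_measureE (~` E))// in muH2.
have HT : H1 `|` H2 = setT.
  by apply/seteqP; split => // x _; have [Ex|nEx] := pselect (E (x, u x));
    [left; exact: EH1|right; exact: EH2].
exists (~` H2), (H1 `&` H2); split.
- exact: measurableC.
- exact: measurableI.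
- have mC2 : measurable (~` H2) by exact: measurableC.
  have mI : measurable (H1 `&` H2) by exact: measurableI.
  have e1 : mu H1 = mu (~` H2) + mu (H1 `&` H2).
    rewrite (measureDI mu mH1 mH2) [LHS]/=; congr (mu _ + _).
    apply/seteqP; split => [x []//|x nH2]; split => //.
    by have [] : (H1 `|` H2) x by rewrite HT.
  have e2 : mu setT = mu (~` H2) + mu H2.
    by rewrite -measureU// ?setICl// setvU.
  have e3 : mu H1 + mu H2 = mu setT.
    rewrite muH1 muH2 -measureU ?setICr// setUv -[in LHS](preimage_setT fst).
    exact: graphical_measure_fst.
  have F A : measurable A -> exists a : R, mu A = a%:E.
    by move=> mA; exists (fine (mu A)); rewrite fineK// fin_num_measure.
  move: e3; rewrite e1 e2.
  have [a ->] := F _ mC2; have [b ->] := F _ mI; have [k ->] := F _ mH2.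
  by rewrite -!EFinD => -[abk]; congr _%:E; lra.
- by move=> x nH2; apply: contrapT => nE; exact/nH2/EH2.
- move=> x Ex; have [H2x|nH2] := pselect (H2 x); last by left.
  by right; split => //; exact: EH1.
Qed.

End graphical_measure_facts.

(** * Lebesgue points along the graph *)

Section lebesgue_points.
Local Open Scope ereal_scope.
Context {R : realType} {n m : nat}.
Variables (mu : {finite_measure set 'rV[R]_n -> \bar R}) (u : 'rV[R]_n -> 'rV[R]_m).
Variable eta : {finite_measure set ('rV[R]_n * 'rV[R]_m)%type -> \bar R}.
Hypothesis etaP : is_graphical_measure mu u eta.

Let measurable_fst_preimage (A : set 'rV[R]_n) :
  measurable A -> measurable (fst @^-1` A : set ('rV[R]_n * 'rV[R]_m)%type).
Proof. by move=> mA; rewrite -[X in measurable X]setTI; exact: measurable_fst. Qed.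

Lemma near_cball_sub (x : 'rV[R]_n) (U : set 'rV[R]_n) : open U -> U x ->
  \forall r \near (0 : R)^'+, cball x r `<=` U.
Proof.
move=> oU Ux; have /nbhs_ballP[e /= e0 eU] : nbhs x U by exact: open_nbhs_nbhs.
near=> r => z zr; apply: eU.
have re : (r < e)%R by near: r; exact: nbhs_right_lt.
split => //= i j; rewrite ord1 /ball /= distrC.
apply: le_lt_trans re; apply: le_trans zr.
by have := normr_coord_le_enorm (z - x) j; rewrite !mxE.
Unshelve. all: by end_near. Qed.

(** The analogue of [cylinder_null_ae] for full cylinders over balls, where
    the null set has to be a union of fibres. *)
Lemma fiber_null_ae (lambda : {charge set ('rV[R]_n * 'rV[R]_m)%type -> \bar R})
    (E : set 'rV[R]_n) :
  measurable E -> lambda.-null_set (fst @^-1` E) ->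
  \forall x \ae mu, E x -> forall t : R, (0 < t)%R ->
    \forall r \near (0 : R)^'+,
      `|lambda (fst @^-1` cball x r)| <= t%:E * mu (cball x r).
Proof.
move=> mE lE; have [V [lV V0]] := charge_total_variation lambda.
apply: (@small_domination_ae R n mu E
  (fun x r => `|lambda (fst @^-1` cball x r)|)) => e e0.
have [nu nuE] := fiber_measure V setT measurableT.
have nuE0 : nu E = 0 by rewrite nuE setIT V0//; exact: measurable_fst_preimage.
have [U [oU EU Ue]] := outer_regular_rV n nu E e mE nuE0 e0.
have mU : measurable U by exact: open_measurable_rV.
have [nuU nuUE] := fiber_measure V _ (measurable_fst_preimage U mU).
exists nuU; first by rewrite nuUE preimage_setT setTI; rewrite nuE setIT in Ue.
move=> x Ex; have := near_cball_sub x U oU (EU x Ex).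
apply: filterS => r rU.
have mB := measurable_fst_preimage _ (measurable_cball n x r).
apply: (le_trans (lV _ mB)); rewrite nuUE.
apply: le_measure; rewrite ?inE//.
  by apply: measurableI => //; exact: measurable_fst_preimage.
by move=> p pr; split => //; exact: rU.
Qed.

Variable Omega : set 'rV[R]_n.
Hypothesis oOmega : open Omega.
Variable g : 'rV[R]_n * 'rV[R]_m -> R.
Hypothesis ig : eta.-integrable (Omega `*` setT) (EFin \o g).

Let W : set ('rV[R]_n * 'rV[R]_m)%type := Omega `*` setT.

Let mW : measurable W.
Proof. by apply: measurableX => //; exact: open_measurable_rV. Qed.

Let mg : measurable_fun W g.
Proof. by apply/measurable_EFinP; exact: (measurable_int eta). Qed.

(** The level cell where [k * e <= g < (k + 1) * e]. *)
Let cell (e : R) (k : int) : set ('rV[R]_n * 'rV[R]_m)%type :=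
  W `&` [set z | (k%:~R * e <= g z)%R /\ (g z < (k%:~R + 1) * e)%R].

Let mcell e k : measurable (cell e k).
Proof.
have -> : cell e k = (W `&` [set z | (k%:~R * e <= g z)%R]) `\`
    (W `&` [set z | ((k%:~R + 1) * e <= g z)%R]).
  apply/seteqP; split => [z [Wz [kl ku]]|z [[Wz kl] nku]].
    by split => // -[_ /=]; rewrite leNgt ku.
  split => //; split => //=; rewrite ltNge; apply/negP => ku.
  exact: nku.
by apply: measurableD; exact: measurable_fun_le.
Qed.

(** A bound of the oscillation of [g] between a point of the cell and the points
    outside it; it vanishes on the cell. *)
Let phi (e : R) (k : int) : 'rV[R]_n * 'rV[R]_m -> \bar R :=
  (fun z => (`|g z| + (`|k%:~R| + 1) * e)%:E) \_ (W `\` cell e k).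

Let iphi e k : eta.-integrable setT (phi e k).
Proof.
have mWc : measurable (W `\` cell e k) by exact: measurableD.
apply/(integrable_mkcond _ mWc).
have -> : (fun z => (`|g z| + (`|k%:~R| + 1) * e)%:E) =
  (abse \o (EFin \o g)) \+ (EFin \o cst ((`|k%:~R| + 1) * e)%R).
  by apply/funext => z /=; rewrite EFinD.
apply: (integrableS mW) => //.
by apply: integrableD => //; [exact: integrable_abse|exact: finite_measure_integrable_cst].
Qed.

Let phi_ge0 e k z : (0 <= e)%R -> 0 <= phi e k z.
Proof.
move=> e0; rewrite /phi /patch; case: ifPn => // _.
by rewrite lee_fin addr_ge0// mulr_ge0// addr_ge0.
Qed.

(** [phi * eta] does not charge the fibres over the points whose graph point
    is in the cell, because [eta] is carried by the graph. *)
Let cell_lebesgue_ae (e : R) k : (0 < e)%R ->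
  \forall x \ae mu, cell e k (x, u x) -> forall t : R, (0 < t)%R ->
    \forall r \near (0 : R)^'+,
      \int[eta]_(z in fst @^-1` cball x r) phi e k z <= t%:E * mu (cball x r).
Proof.
move=> e0.
have [E' [Z [mE' mZ Z0 E'E EE']]] := graph_preimage_borel mu u eta etaP _ (mcell e k).
pose lambda : {charge set ('rV[R]_n * 'rV[R]_m)%type -> \bar R} :=
  induced_charge (iphi e k).
have lnull : lambda.-null_set (fst @^-1` E').
  move=> B mB BE'; rewrite /lambda/= /induced_charge.
  have mBc : measurable (B `\` cell e k) by exact: measurableD.
  have mp D : measurable_fun D (phi e k).
    by apply: (measurable_funS measurableT) => //; exact: (measurable_int eta).
  have eta0 : eta (B `\` cell e k) = 0.
    rewrite (graphical_measureE mu u eta etaP)//.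
    rewrite (_ : [set x | _] = set0) ?mu_ext0//.
    by apply/seteqP; split => // x [Bx]; apply; apply: E'E; exact: BE' Bx.
  rewrite -(setUIDK B (cell e k)) ge0_integral_setU//.
  - rewrite [X in X + _](_ : _ = 0); last first.
      rewrite -[RHS](integral0 eta (B `&` cell e k)); apply: eq_integral => z.
      by rewrite inE => -[_ cz]; rewrite /phi patchN// notin_setE => -[_]; apply.
    by rewrite add0e; exact: null_set_integral.
  - exact: measurableI.
  - by move=> z _; apply: phi_ge0; exact: ltW.
  - by apply/disj_setPS => z [[_ cz] [_ ncz]].
have aeZ : \forall x \ae mu, ~ Z x.
  by exists Z; split => // x /contrapT.
have := fiber_null_ae lambda E' mE' lnull.
apply: filterS2 aeZ => x nZ h cx t t0.
have E'x : E' x by have [|] := EE' x cx.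
have := h E'x t t0; apply: filterS => r.
rewrite gee0_abs// /lambda/= /induced_charge; apply: integral_ge0 => z _.
by apply: phi_ge0; exact: ltW.
Qed.

Lemma graph_lebesgue_point_ae :
  \forall x \ae mu, Omega x -> forall t : R, (0 < t)%R ->
    \forall r \near (0 : R)^'+,
      \int[eta]_(z in fst @^-1` cball x r) `|g z - g (x, u x)|%:E
        <= t%:E * mu (cball x r).
Proof.
pose T (j : nat) : R := (j.+1%:R^-1)%R.
have T0 j : (0 < T j)%R by rewrite invr_gt0.
pose s i : nat * int := odflt (0%N, 0%R) (unpickle i).
have := ae_foralln (fun i => cell_lebesgue_ae (T (s i).1) (s i).2 (T0 (s i).1)).
apply: filterS => x hx Ox t t0.
(* the cell height [e] contributes once through the oscillation on the cell and
   once through [phi], hence the bound by half of [t] *)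
have [j jt] : exists j : nat, (T j <= t / 2)%R.
  have t2 : (0 < t / 2)%R by rewrite divr_gt0.
  exists (Num.truncn (t / 2)^-1)%R; rewrite /T -[leRHS]invrK.
  by rewrite lef_pV2 ?posrE ?invr_gt0//; exact/ltW/truncnS_gt.
pose e := T j; pose gx := g (x, u x).
pose k : int := Num.floor (gx / e)%R.
have e0 : (0 < e)%R by exact: T0.
have /andP[kl' ku'] := floor_itv (gx / e)%R.
have kl : (k%:~R * e <= gx)%R by rewrite -ler_pdivlMr.
have ku : (gx < (k%:~R + 1) * e)%R by rewrite -ltr_pdivrMr// -intrD1.
have cx : cell e k (x, u x) by [].
have := hx (pickle (j, k)); rewrite /s pickleK/= => /(_ cx e e0) h1.
have h2 := near_cball_sub x Omega oOmega Ox.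
near=> r.
have xrO : cball x r `<=` Omega by near: r.
have le1 : \int[eta]_(z in fst @^-1` cball x r) phi e k z <= e%:E * mu (cball x r).
  by near: r.
have mB := measurable_fst_preimage _ (measurable_cball n x r).
have BW : fst @^-1` cball x r `<=` W by move=> z /xrO.
have mp D : measurable_fun D (phi e k).
  by apply: (measurable_funS measurableT) => //; exact: (measurable_int eta).
have mgB : measurable_fun (fst @^-1` cball x r) g by apply: measurable_funS mg.
apply: (@le_trans _ _ (\int[eta]_(z in fst @^-1` cball x r) (e%:E + phi e k z))).
  apply: ge0_le_integral => //.
  - by apply/measurable_EFinP; apply: measurableT_comp => //; exact: measurable_funB.
  - exact: emeasurable_funD.
  - move=> z /BW Wz; rewrite /phi /patch; case: ifPn => [_|]; last first.
      rewrite notin_setE => /not_andP[//|/contrapT [_ [zl zu]]].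
      move: zl zu kl ku; rewrite /= -/gx mulrDl mul1r => zl zu kl ku.
      by rewrite adde0 lee_fin ler_norml; apply/andP; split; lra.
    rewrite -EFinD lee_fin (le_trans (ler_normB _ _))//.
    have gxk : (`|gx| <= (`|k%:~R| + 1) * e)%R.
      rewrite ler_norml; apply/andP; split.
        apply: le_trans kl; rewrite -mulNr ler_pM2r//.
        by rewrite opprD -[leRHS]addr0 lerD ?lerN10// lerNl -normrN ler_norm.
      apply/ltW/(lt_le_trans ku); rewrite ler_pM2r// lerD2r ler_norm//.
    by rewrite addrCA lerD2l (le_trans gxk)// lerDr ltW.
rewrite ge0_integralD//; last 2 first.
- by move=> z _; rewrite lee_fin ltW.
- by move=> z _; apply: phi_ge0; exact: ltW.
have etaB := graphical_measure_fst mu u eta etaP _ (measurable_cball n x r).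
rewrite integral_cst// [X in _ * X + _](_ : _ = mu (cball x r)); last exact: etaB.
apply: (@le_trans _ _ ((e + e)%:E * mu (cball x r))).
  have -> : (e + e)%:E * mu (cball x r) = e%:E * mu (cball x r) + e%:E * mu (cball x r).
    by rewrite EFinD ge0_muleDl// lee_fin ltW.
  by apply: leeD.
apply: lee_wpmul2r => //; rewrite lee_fin [leRHS]splitr.
by apply: lerD.
Unshelve. all: by end_near. Qed.

End lebesgue_points.

(** * Ratios, almost-everywhere transfer and densities *)

Section ratios.
Context {R : realType} {n : nat}.
Variable mu : {finite_measure set 'rV[R]_n -> \bar R}.

(** When [mu] of the ball is 0 the ratio is 0 by the convention on inverses. *)
Lemma ratio_cvg0 (x : 'rV[R]_n) (L : R -> \bar R) :
  (forall r, L r \is a fin_num) ->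
  (forall t : R, 0 < t ->
    \forall r \near (0 : R)^'+, (`|L r| <= t%:E * mu (cball x r))%E) ->
  (fine (mu (closure (eball x r))))^-1 * fine (L r) @[r --> 0^'+] --> (0 : R).
Proof.
move=> Lfin Lt; apply/cvgr0Pnorm_le => t t0; near=> r.
have r0 : 0 < r by near: r; exact: nbhs_right_gt.
have : (`|L r| <= t%:E * mu (cball x r))%E by near: r; exact: Lt.
rewrite closure_eball// -(fineK (Lfin r)).
have mB := measurable_cball n x r.
rewrite -[X in (_ * X)%E]fineK; last exact: fin_num_measure.
rewrite abse_EFin -EFinM lee_fin => h /=; rewrite normrM normfV.
have a0 : 0 <= fine (mu (cball x r)) by exact: fine_ge0.
rewrite (ger0_norm a0).
have [->|an0] := eqVneq (fine (mu (cball x r))) 0.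
  by rewrite invr0 mul0r ltW.
by rewrite mulrC ler_pdivrMr// lt_neqAle eq_sym an0.
Unshelve. all: by end_near. Qed.

End ratios.

Lemma cvg_row {R : realType} {T : Type} {F : set_system T} {FF : Filter F}
    (k : nat) (f : T -> 'rV[R]_k) (l : 'rV[R]_k) :
  (forall i, f t 0 i @[t --> F] --> l 0 i) -> f @ F --> l.
Proof.
move=> fl; apply/cvg_ballP => e e0.
have : \forall t \near F, forall i, ball (l 0 i) e (f t 0 i).
  by apply: filter_forall => i; have /cvg_ballP := fl i; exact.
by apply: filterS => t ht; split => // i j; rewrite ord1; exact: ht.
Qed.

Section ae_graph.
Context {R : realType} {n m : nat}.
Variables (mu : {finite_measure set 'rV[R]_n -> \bar R}) (u : 'rV[R]_n -> 'rV[R]_m).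
Variable eta : {finite_measure set ('rV[R]_n * 'rV[R]_m)%type -> \bar R}.
Hypothesis etaP : is_graphical_measure mu u eta.

Lemma ae_graph_lift (P : 'rV[R]_n -> Prop) :
  (\forall x \ae mu, P x) ->
  \forall z \ae eta, forall x, z = (x, u x) -> P x.
Proof.
move=> [M [mM M0 PM]]; exists (fst @^-1` M); split.
- by rewrite -[X in measurable X]setTI; exact: measurable_fst.
- by rewrite (graphical_measure_fst mu u eta etaP).
- move=> z /= /existsNP[x /not_implyP[-> nP]]; exact: PM.
Qed.

Lemma ae_graph_descend (P : 'rV[R]_n * 'rV[R]_m -> Prop) :
  (\forall z \ae eta, P z) -> \forall x \ae mu, P (x, u x).
Proof.
move=> [M [mM M0 PM]].
have [H [mH MH muH]] := measurable_hull mu [set x | M (x, u x)].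
exists H; split => //; last by move=> x /= nP; apply: MH; exact: PM.
by rewrite muH -(graphical_measureE mu u eta etaP).
Qed.

Lemma ae_not_null (A : set ('rV[R]_n * 'rV[R]_m)%type) :
  measurable A -> eta.-null_set A -> \forall x \ae mu, (~` A) (x, u x).
Proof.
move=> mA A0; apply: (ae_graph_descend (~` A)); exists A; split => //.
  exact: A0.
by move=> z /contrapT.
Qed.

End ae_graph.

Section density.
Local Open Scope ereal_scope.
Context {d : measure_display} {T : measurableType d} {R : realType}.
Variables (lambda : {charge set T -> \bar R}) (eta : {finite_measure set T -> \bar R}).

Lemma ac_partP : exists lambda_s : {charge set T -> \bar R},
  [/\ ac_part lambda eta `<< eta, mutually_singular lambda_s eta &
      forall A, measurable A -> lambda A = ac_part lambda eta A + lambda_s A].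
Proof. by rewrite /ac_part; case: cid. Qed.

Lemma ac_density_fin_num z : ac_density lambda eta z \is a fin_num.
Proof. by have [? [? _ _]] := ac_partP; exact: Radon_Nikodym_fin_num. Qed.

Lemma integrable_ac_density : eta.-integrable setT (ac_density lambda eta).
Proof. by have [? [? _ _]] := ac_partP; exact: Radon_Nikodym_integrable. Qed.

Lemma ac_part_integral A : measurable A ->
  ac_part lambda eta A = \int[eta]_(z in A) ac_density lambda eta z.
Proof. by move=> mA; have [? [? _ _]] := ac_partP; exact: Radon_Nikodym_integral. Qed.

(** The absolutely continuous part of a singular charge is both absolutely
    continuous and singular, hence zero. *)
Lemma singular_ac_density : mutually_singular lambda eta ->
  \forall z \ae eta, ac_density lambda eta z = 0.
Proof.
move=> [A [mA lA etaA]].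
have [ls [/null_content_dominatesP ac [B [mB lsB etaB]] lE]] := ac_partP.
have ac0 C : measurable C -> ac_part lambda eta C = 0.
  move=> mC; pose D := A `|` B.
  have mD : measurable D by exact: measurableU.
  have mCD : measurable (C `&` D) by exact: measurableI.
  have mCD' : measurable (C `\` D) by exact: measurableD.
  have etaD : eta D = 0.
    apply/eqP; rewrite -measure_le0.
    have : eta (A `|` B) <= eta A + eta B by exact: measureU2.
    by rewrite (etaA A)// (etaB B)// adde0.
  have acI : ac_part lambda eta (C `&` D) = 0.
    apply: ac => //; apply/eqP; rewrite -measure_le0 -etaD.
    by apply: le_measure; rewrite ?inE//; exact: subIsetr.
  have acD : ac_part lambda eta (C `\` D) = 0.
    have := lE _ mCD'.
    rewrite lA// => [|z [_ /not_orP[]//]].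
    rewrite lsB// => [|z [_ /not_orP[]//]].
    by rewrite adde0.
  by rewrite (chargeDI _ mC mD) acI acD adde0.
have : ae_eq eta setT (ac_density lambda eta) (cst 0).
  apply: integral_ae_eq => //; first exact: integrable_ac_density.
  by move=> E _ mE; rewrite -ac_part_integral// ac0// integral0.
by apply: filterS => z /(_ Logic.I).
Qed.

End density.

(** * Limits along the graph *)

Section graph_limits.
Context {R : realType} {n m : nat}.
Variables (mu : {finite_measure set 'rV[R]_n -> \bar R}) (u : 'rV[R]_n -> 'rV[R]_m).
Variable eta : {finite_measure set ('rV[R]_n * 'rV[R]_m)%type -> \bar R}.
Hypothesis etaP : is_graphical_measure mu u eta.
Variable Omega : set 'rV[R]_n.
Variables (c : 'rV[R]_n -> R -> R) (y : 'rV[R]_n -> R -> 'rV[R]_m).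
Hypothesis c_cvg : forall x, Omega x -> c x r @[r --> 0^'+] --> (0 : R).
Hypothesis y_cvg : forall x, Omega x -> y x r @[r --> 0^'+] --> u x.

Let cyl x r := closed_cylinder x r (y x r) (c x r).

Let mcyl x r : measurable (cyl x r).
Proof. exact: measurable_closed_cylinder. Qed.

Lemma singular_cylinder_cvg0
    (lambda : {charge set ('rV[R]_n * 'rV[R]_m)%type -> \bar R}) :
  mutually_singular lambda eta ->
  \forall x \ae mu, Omega x ->
    (fine (mu (closure (eball x r))))^-1 * fine (lambda (cyl x r))
      @[r --> 0^'+] --> (0 : R).
Proof.
move=> [A [mA lA etaA]].
have mAC : measurable (~` A) by exact: measurableC.
have := cylinder_null_ae mu Omega u c y c_cvg y_cvg lambda (~` A) mAC lA.
apply: filterS2 (ae_not_null mu u eta etaP A mA etaA) => x Ax h Ox.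
apply: ratio_cvg0 => [r|]; last exact: h.
exact: fin_num_measure.
Qed.

Lemma density_cylinder_cvg
    (lambda : {charge set ('rV[R]_n * 'rV[R]_m)%type -> \bar R}) :
  open Omega ->
  \forall x \ae mu, Omega x ->
    fine (eta (cyl x r)) / fine (mu (closure (eball x r)))
      @[r --> 0^'+] --> (1 : R) ->
    (fine (mu (closure (eball x r))))^-1 * fine (lambda (cyl x r))
      @[r --> 0^'+] --> fine (ac_density lambda eta (x, u x)).
Proof.
move=> oOmega; pose g z := fine (ac_density lambda eta z).
have gE : EFin \o g = ac_density lambda eta.
  by apply/funext => z /=; rewrite fineK// ac_density_fin_num.
have ig : eta.-integrable setT (EFin \o g) by rewrite gE; exact: integrable_ac_density.
have mO : measurable (Omega `*` setT : set ('rV[R]_n * 'rV[R]_m)%type).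
  by apply: measurableX => //; exact: open_measurable_rV.
have igO : eta.-integrable (Omega `*` setT) (EFin \o g) by exact: integrableS ig.
have [ls [_ /singular_cylinder_cvg0 aes lE]] := ac_partP lambda eta.
have := graph_lebesgue_point_ae mu u eta etaP Omega oOmega g igO.
apply: filterS2 aes => x hs hl Ox eta1.
have {hs} hs := hs Ox; have {hl} hl := hl Ox.
pose L r : \bar R := (ac_part lambda eta (cyl x r) - (g (x, u x))%:E * eta (cyl x r))%E.
have Lfin r : L r \is a fin_num.
  by rewrite fin_numB fin_numM// ?fin_num_measure//; apply: fin_num_measure.
have Ll t : 0 < t ->
    \forall r \near (0 : R)^'+, (`|L r| <= t%:E * mu (cball x r))%E.
  move=> t0; have := hl t t0; apply: filterS => r; apply: le_trans.
  have mB : measurable (fst @^-1` cball x r : set ('rV[R]_n * 'rV[R]_m)%type).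
    by rewrite -[X in measurable X]setTI; apply: measurable_fst => //; exact: measurable_cball.
  have igc : eta.-integrable (cyl x r) (EFin \o g) by exact: integrableS ig.
  have -> : L r = (\int[eta]_(z in cyl x r) ((g z)%:E - (g (x, u x))%:E))%E.
    rewrite integralB_EFin//; last exact: finite_measure_integrable_cst.
    by rewrite integral_cst// /L ac_part_integral// -gE.
  have mgT D : measurable_fun D g.
    apply: (measurable_funS measurableT) => //.
    by apply/measurable_EFinP; exact: (measurable_int eta).
  have mgB D : measurable_fun D (fun z => (g z - g (x, u x))%:E).
    by apply/measurable_EFinP; exact: measurable_funB.
  apply: le_trans (le_abse_integral _ _ _) _ => //.
  apply: ge0_subset_integral => //.
    by apply: measurableT_comp => //.
  by move=> z /closed_cylinder_sub[].
have := ratio_cvg0 mu x L Lfin Ll.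
move: hs eta1 => hs eta1 hL.
have -> : fine (ac_density lambda eta (x, u x)) = 0 + g (x, u x) * 1 + 0.
  by rewrite mulr1 add0r addr0.
have -> : (fun r => (fine (mu (closure (eball x r))))^-1 * fine (lambda (cyl x r))) =
  (fun r => (fine (mu (closure (eball x r))))^-1 * fine (L r) +
     g (x, u x) * (fine (eta (cyl x r)) / fine (mu (closure (eball x r)))) +
     (fine (mu (closure (eball x r))))^-1 * fine (ls (cyl x r))).
  apply/funext => r; rewrite lE// /L fineD ?fin_num_measure//.
  rewrite fineB ?fin_numM ?fin_num_measure// fineM ?fin_num_measure//=.
  ring.
by apply: cvgD => //; apply: cvgD => //; apply: cvgMr.
Qed.

Lemma lebesgue_point_cvg (g : 'rV[R]_n * 'rV[R]_m -> R) : open Omega ->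
  eta.-integrable (Omega `*` setT) (EFin \o g) ->
  \forall x \ae mu, Omega x ->
    (((fine (mu (closure (eball x r))))^-1)%:E *
      \int[eta]_(z in closure (eball x r) `*` setT) `|g z - g (x, u x)|%:E)%E
      @[r --> 0^'+] --> 0%E.
Proof.
move=> oOmega ig.
have := graph_lebesgue_point_ae mu u eta etaP Omega oOmega g ig.
apply: filterS => x hl Ox; have {hl} hl := hl Ox.
pose I r := (\int[eta]_(z in fst @^-1` cball x r) `|g z - g (x, u x)|%:E)%E.
have I0 r : (0 <= I r)%E by apply: integral_ge0 => z _; rewrite lee_fin.
have Ifin : \forall r \near (0 : R)^'+, I r \is a fin_num.
  have := hl 1 ltr01; apply: filterS => r Ir.
  rewrite ge0_fin_numE//; apply: (le_lt_trans Ir).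
  by rewrite mul1e ltey_eq fin_num_measure//; exact: measurable_cball.
have h : (fine (mu (closure (eball x r))))^-1 * fine (I r) @[r --> 0^'+] --> (0 : R).
  apply: (ratio_cvg0 mu x (fun r => (fine (I r))%:E)) => // t t0.
  have := hl t t0; apply: filterS2 Ifin => r Irfin.
  by rewrite fineK// gee0_abs.
apply/fine_cvgP.
have near_eq : \forall r \near (0 : R)^'+,
  (((fine (mu (closure (eball x r))))^-1)%:E *
      \int[eta]_(z in closure (eball x r) `*` setT) `|g z - g (x, u x)|%:E)%E =
  ((fine (mu (closure (eball x r))))^-1 * fine (I r))%:E.
  near=> r.
  have r0 : 0 < r by near: r; exact: nbhs_right_gt.
  have Irfin : I r \is a fin_num by near: r.
  rewrite EFinM fineK// /I closure_eball//; congr (_ * integral _ _ _)%E.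
  by apply/seteqP; split => [z []|z].
split; first by apply: filterS near_eq => r /= ->.
apply: cvg_trans h; apply: near_eq_cvg.
by apply: filterS near_eq => r /= ->.
Unshelve. all: by end_near. Qed.

End graph_limits.

(* Measures on Omega (resp. on Omega x R^m) are represented by the Borel
   measures on R^d (resp. R^d x R^m) that vanish outside Omega (resp. outside
   Omega x R^m); finite Borel measures on these spaces are Radon. *)
Theorem theorem5p1 (R : realType) (d m : nat)
    (d_gt0 : (0 < d)%N) (m_gt0 : (0 < m)%N)
    (Omega : set 'rV[R]_d) (OmegaP : bounded_lipschitz_domain Omega)
    (mu : {finite_measure set 'rV[R]_d -> \bar R}) (mu_Omega : mu (~` Omega) = 0%E)
    (u : 'rV[R]_d -> 'rV[R]_m) (mu_u : mu_measurable mu Omega u)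
    (eta : {finite_measure set ('rV[R]_d * 'rV[R]_m)%type -> \bar R})
    (etaP : is_graphical_measure mu u eta)
    (c : 'rV[R]_d -> R -> R) (y : 'rV[R]_d -> R -> 'rV[R]_m)
    (c_gt0 : forall x r, Omega x -> 0 < r -> 0 < c x r)
    (c_cvg : forall x, Omega x -> c x r @[r --> 0^'+] --> (0 : R))
    (y_cvg : forall x, Omega x -> y x r @[r --> 0^'+] --> u x) :
  [/\
    (* (i) *)
    forall (k : nat)
      (lambda : 'I_k -> {charge set ('rV[R]_d * 'rV[R]_m)%type -> \bar R}),
      vnull lambda (~` (Omega `*` setT)) -> vsingular lambda eta ->
      \forall z \ae eta, forall x, Omega x -> z = (x, u x) ->
        [/\ vdensity lambda eta (x, u x) = 0,
            (fine (pushforward eta fst (closure (eball x r))))^-1 *: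
              vval lambda (closed_cylinder x r (y x r) (c x r))
              @[r --> 0^'+] --> vdensity lambda eta (x, u x) &
            (fine (mu (closure (eball x r))))^-1 *:
              vval lambda (closed_cylinder x r (y x r) (c x r))
              @[r --> 0^'+] --> vdensity lambda eta (x, u x)],
    (* (ii) *)
    forall g : 'rV[R]_d * 'rV[R]_m -> R,
      eta.-integrable (Omega `*` setT) (EFin \o g) ->
      \forall x \ae mu, Omega x ->
        (((fine (mu (closure (eball x r))))^-1)%:E *
          \int[eta]_(z in closure (eball x r) `*` setT)
            `|g z - g (x, u x)|%:E)%E
          @[r --> 0^'+] --> 0%E &
    (* (iii) *)
    forall (k : nat)
      (lambda : 'I_k -> {charge set ('rV[R]_d * 'rV[R]_m)%type -> \bar R}),
      vnull lambda (~` (Omega `*` setT)) ->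
      \forall z \ae eta, forall x, Omega x -> z = (x, u x) ->
        fine (eta (closed_cylinder x r (y x r) (c x r))) /
          fine (mu (closure (eball x r))) @[r --> 0^'+] --> (1 : R) ->
        ((fine (pushforward eta fst (closure (eball x r))))^-1 *:
            vval lambda (closed_cylinder x r (y x r) (c x r))
            @[r --> 0^'+] --> vdensity lambda eta (x, u x)) /\
        ((fine (mu (closure (eball x r))))^-1 *:
            vval lambda (closed_cylinder x r (y x r) (c x r))
            @[r --> 0^'+] --> vdensity lambda eta (x, u x))].
Proof.
have oO : open Omega by have [_ ? _ _ _] := OmegaP.
have pfE x r : pushforward eta fst (closure (eball x r)) = mu (closure (eball x r)).
  rewrite /pushforward; apply: (graphical_measure_fst mu u eta etaP).
  by apply: closed_measurable_rV; exact: closed_closure.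
have entry k (lambda : 'I_k -> {charge set ('rV[R]_d * 'rV[R]_m)%type -> \bar R})
    x r i : ((fine (mu (closure (eball x r))))^-1 *:
      vval lambda (closed_cylinder x r (y x r) (c x r))) 0 i =
    (fine (mu (closure (eball x r))))^-1 *
      fine (lambda i (closed_cylinder x r (y x r) (c x r))).
  by rewrite !mxE.
split.
- move=> k lambda _ [A [mA lA etaA]].
  have sing i : mutually_singular (lambda i) eta by exists A; split => //; exact: lA.
  have ae1 : \forall x \ae mu, forall i, Omega x ->
      (fine (mu (closure (eball x r))))^-1 *
        fine (lambda i (closed_cylinder x r (y x r) (c x r))) @[r --> 0^'+] --> (0 : R).
    apply: filter_forall => i.
    exact: (singular_cylinder_cvg0 mu u eta etaP Omega c y c_cvg y_cvg (lambda i)).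
  have ae2 : \forall z \ae eta, forall i, ac_density (lambda i) eta z = 0%E.
    by apply: filter_forall => i; exact: singular_ac_density.
  have := ae_graph_lift mu u eta etaP _ ae1.
  apply: filterS2 ae2 => z z0 hz x Ox zE; move/(_ x zE) in hz.
  have v0 : vdensity lambda eta (x, u x) = 0.
    by apply/rowP => i; rewrite !mxE -zE z0.
  have lim0 : (fine (mu (closure (eball x r))))^-1 *:
      vval lambda (closed_cylinder x r (y x r) (c x r))
      @[r --> 0^'+] --> vdensity lambda eta (x, u x).
    apply: cvg_row => i; under eq_fun do rewrite entry.
    by rewrite v0 mxE; exact: hz.
  by split => //; under eq_fun do rewrite pfE.
- by move=> g ig; exact: (lebesgue_point_cvg mu u eta etaP Omega g oO ig).
- move=> k lambda _.
  have ae1 : \forall x \ae mu, forall i, Omega x ->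
      fine (eta (closed_cylinder x r (y x r) (c x r))) /
        fine (mu (closure (eball x r))) @[r --> 0^'+] --> (1 : R) ->
      (fine (mu (closure (eball x r))))^-1 *
        fine (lambda i (closed_cylinder x r (y x r) (c x r)))
        @[r --> 0^'+] --> fine (ac_density (lambda i) eta (x, u x)).
    apply: filter_forall => i.
    exact: (density_cylinder_cvg mu u eta etaP Omega c y c_cvg y_cvg (lambda i) oO).
  have := ae_graph_lift mu u eta etaP _ ae1.
  apply: filterS => z hz x Ox zE eta1; move/(_ x zE) in hz.
  have lim : (fine (mu (closure (eball x r))))^-1 *:
      vval lambda (closed_cylinder x r (y x r) (c x r))
      @[r --> 0^'+] --> vdensity lambda eta (x, u x).
    apply: cvg_row => i; under eq_fun do rewrite entry.
    by rewrite mxE; exact: hz.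
  by split => //; under eq_fun do rewrite pfE.
Qed.
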